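(* Let $\Delta$ and $\Gamma$ be finite simplicial graphs with $|V(\Delta)|=n$ and $|V(\Gamma)|=m$. Then $\mathbb{G}(\Delta)$ and $\mathbb{G}(\Gamma)$ are universally equivalent if and only if there exist tame embeddings $\varphi:\mathbb{G}(\Delta)\to\mathbb{G}(\Gamma_n)$ and $\psi:\mathbb{G}(\Gamma)\to\mathbb{G}(\Delta_m)$.
   Context: $\mathbb{G}(\Gamma)=\langle V(\Gamma)\mid [x,y]=1 \text{ for } (x,y)\in E(\Gamma)\rangle$. Two groups are universally equivalent if they satisfy the same universal sentences in the language of groups. The $k$-inflation $\Gamma_k$ has vertices $v_1,\dots,v_k$ for each $v\in V(\Gamma)$; $v_i,v_j$ adjacent for $i\ne j$, and $v_i,w_l$ ($v\ne w$) adjacent iff $(v,w)\in E(\Gamma)$; so $\mathbb{G}(\Gamma_k)$ is the graph product over $\Gamma$ with vertex groups $\mathbb{Z}^k$. An embedding $\varphi:\mathbb{G}(\Delta)\to\mathbb{G}(\Lambda)$ is tame if for each $x_i\in V(\Delta)$, $\varphi(x_i)=y_{i1}\cdots y_{ir_i}$ where $y_{ij}=g_{ij}^{-1}x_{ij}'^{\,n_{ij}}g_{ij}$ with $x'_{ij}\in V(\Lambda)$, $n_{ij}\in\mathbb{Z}$, $g_{ij}\in\mathbb{G}(\Lambda)$, the $y_{i1},\dots,y_{ir_i}$ pairwise commute, and the conjugates $g_{ij}^{-1}x'_{ij}g_{ij}$ are pairwise distinct over all pairs $(i,j)$. *)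

(* Defs.v *)
From Stdlib Require Import Relations.
From mathcomp Require Import all_boot.
From mathcomp Require Import ssralg ssrint.
Set Implicit Arguments. Unset Strict Implicit. Unset Printing Implicit Defensive.

Definition simple_graph (V : finType) (e : rel V) : Prop :=
  symmetric e /\ irreflexive e.

(* Words in the generators and their inverses: (v, true) = v, (v, false) = v^-1. *)
Definition word (V : Type) := seq (V * bool)%type.

Inductive raag_step (V : Type) (e : V -> V -> bool) : word V -> word V -> Prop :=
| step_cancel (u v : word V) (x : V) (b : bool) :
    raag_step e (u ++ [:: (x, b); (x, ~~ b)] ++ v) (u ++ v)
| step_comm (u v : word V) (x y : V) (bx bY : bool) :
    e x y -> raag_step e (u ++ [:: (x, bx); (y, bY)] ++ v) (u ++ [:: (y, bY); (x, bx)] ++ v).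

(* Equality in G(Gamma) = <V | [x,y]=1 for (x,y) in E> : the equivalence
   relation generated by the elementary moves (the group is word V modulo it,
   with concatenation as product, [::] as unit and winv as inverse). *)
Definition raag_eq (V : Type) (e : V -> V -> bool) : relation (word V) :=
  clos_refl_sym_trans (word V) (raag_step e).

Definition winv (V : Type) (w : word V) : word V :=
  rev (map (fun p => (p.1, ~~ p.2)) w).

Definition wconj (V : Type) (g u : word V) : word V := winv g ++ u ++ g.

Definition wpow (V : Type) (x : V) (n : int) : word V :=
  match n with
  | Posz k => nseq k (x, true)
  | Negz k => nseq k.+1 (x, false)
  end.

Definition hom_ext (V W : Type) (f : V -> word W) (w : word V) : word W :=
  flatten (map (fun p => if p.2 then f p.1 else winv (f p.1)) w).

Definition is_hom (V W : Type) (eV : V -> V -> bool) (eW : W -> W -> bool)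
  (f : V -> word W) : Prop :=
  forall w1 w2, raag_eq eV w1 w2 -> raag_eq eW (hom_ext f w1) (hom_ext f w2).

Definition is_embedding (V W : Type) (eV : V -> V -> bool) (eW : W -> W -> bool)
  (f : V -> word W) : Prop :=
  is_hom eV eW f /\
  forall w1 w2, raag_eq eW (hom_ext f w1) (hom_ext f w2) -> raag_eq eV w1 w2.

Definition tame_piece (W : Type) (d : W * int * word W) : word W :=
  wconj d.2 (wpow d.1.1 d.1.2).

Definition tame_conj (W : Type) (d : W * int * word W) : word W :=
  wconj d.2 [:: (d.1.1, true)].

Definition tame_embedding (V W : Type) (eV : V -> V -> bool) (eW : W -> W -> bool)
  (f : V -> word W) : Prop :=
  is_embedding eV eW f /\
  exists (r : V -> nat) (data : forall x : V, 'I_(r x) -> (W * int * word W)%type),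
    (forall x, raag_eq eW (f x)
                 (flatten [seq tame_piece (data x j) | j <- enum 'I_(r x)])) /\
    (forall x (j k : 'I_(r x)),
        raag_eq eW (tame_piece (data x j) ++ tame_piece (data x k))
                   (tame_piece (data x k) ++ tame_piece (data x j))) /\
    (forall x x' (j : 'I_(r x)) (k : 'I_(r x')),
        (x <> x' \/ nat_of_ord j <> nat_of_ord k) ->
        ~ raag_eq eW (tame_conj (data x j)) (tame_conj (data x' k))).

Definition infl_rel (V : finType) (e : rel V) (k : nat) : rel (V * 'I_k)%type :=
  fun a b => if a.1 == b.1 then a.2 != b.2 else e a.1 b.1.

Inductive gterm : Type :=
| TVar of nat
| TOne
| TMul of gterm & gterm
| TInv of gterm.

Inductive qf_formula : Type :=
| FEq of gterm & gterm
| FNot of qf_formula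
| FAnd of qf_formula & qf_formula
| FOr of qf_formula & qf_formula.

Fixpoint eval_term (V : Type) (s : nat -> word V) (t : gterm) : word V :=
  match t with
  | TVar i => s i
  | TOne => [::]
  | TMul a b => eval_term s a ++ eval_term s b
  | TInv a => winv (eval_term s a)
  end.

Fixpoint holds (V : Type) (e : V -> V -> bool) (s : nat -> word V) (f : qf_formula) : Prop :=
  match f with
  | FEq a b => raag_eq e (eval_term s a) (eval_term s b)
  | FNot g => ~ holds e s g
  | FAnd g h => holds e s g /\ holds e s h
  | FOr g h => holds e s g \/ holds e s h
  end.

(* G(e) satisfies the universal sentence  forall x_0 x_1 ..., f . *)
Definition models_univ (V : Type) (e : V -> V -> bool) (f : qf_formula) : Prop :=
  forall s : nat -> word V, holds e s f.

Definition univ_equiv (V W : Type) (eV : V -> V -> bool) (eW : W -> W -> bool) : Prop :=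
  forall f : qf_formula, models_univ eV f <-> models_univ eW f.

Arguments infl_rel {V} e k.

(* Main.v *)
Require Import Defs.
From Stdlib Require Import Relations Classical.
From mathcomp Require Import all_boot.
From mathcomp Require Import ssralg ssrnum ssrint zify.
Set Implicit Arguments. Unset Strict Implicit. Unset Printing Implicit Defensive.
Import GRing.Theory Num.Theory.

(** In G(Gamma) reduced words are unique up to commutations, and a word up to
    commutations (a trace) is determined by its projections to pairs of non-commuting
    vertices. For a conjugate t of a vertex x, let e_t(h) be the
    exponent with which h crosses the line of t.

    If G(Delta) embeds in G(Gamma_n), the universal theory passes to G(Delta), because
    the maps (v,i) |-> v^(N^i) from G(Gamma_n) to G(Gamma) are injective on any finite
    set for large N.

    Conversely, universal equivalence yields homomorphisms a : G(Delta) -> G(Gamma)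
    that are non-trivial on any given finite set of non-trivial elements. Split each
    a(x_i), cyclically reduced, into its commuting pure factors b_ir. The projections
    show that commuting pure factors have either commuting supports or equal supports
    and a common centralizer, so one can choose conjugates t_ir of vertices, generic
    enough in the parabolic subgroup of b_ir, with [t_ir,t_ks] = 1 implying
    [b_ir,b_ks] = 1, and with all t_ir, t_ks commuting when a(x_i), a(x_k) commute.
    Let A be the group on letters (i,r) that commute as the t_ir do. Then a factors
    through theta : x_i |-> prod_r (i,r) in A. There are only finitely many such
    patterns, so if a avoids one kernel element for each non-injective pattern, theta
    is injective. Finally sending (i,r) to the N-th power of the lift of t_ir to the
    i-th copy in Gamma_n is injective on A by ping-pong, since e_t and e_t' cannot
    both be large when t and t' do not commute. *)

(** * Words, traces and reduced words *)

Section Words.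
Variables (V : finType) (e : rel V).
Hypotheses (e_sym : symmetric e) (e_irr : irreflexive e).
Implicit Types (u v w : word V) (l k : V * bool) (x y z : V).

Notation req := (raag_eq e).

Definition linv l : V * bool := (l.1, ~~ l.2).

Lemma linvK : involutive linv.
Proof. by case=> x b; rewrite /linv /= negbK. Qed.

Lemma linv_neq l : (linv l == l) = false.
Proof. by case: l => x []; rewrite /linv xpair_eqE andbF. Qed.

Lemma winvE w : winv w = rev (map linv w).
Proof. by []. Qed.

Lemma winvK : involutive (@winv V).
Proof.
move=> w; rewrite !winvE map_rev revK -map_comp -[RHS]map_id.
by apply: eq_map => l; exact: linvK.
Qed.

Lemma winv_cat u w : winv (u ++ w) = winv w ++ winv u.
Proof. by rewrite !winvE map_cat rev_cat. Qed.

Lemma winv_cons l w : winv (l :: w) = winv w ++ [:: linv l].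
Proof. by rewrite !winvE /= rev_cons cats1. Qed.

Lemma size_winv w : size (winv w) = size w.
Proof. by rewrite winvE size_rev size_map. Qed.

Lemma all_winv (a : pred V) w : all (fun l => a l.1) (winv w) = all (fun l => a l.1) w.
Proof. by rewrite winvE all_rev all_map. Qed.

Lemma req_refl w : req w w. Proof. exact: rst_refl. Qed.
Lemma req_sym u w : req u w -> req w u. Proof. exact: rst_sym. Qed.
Lemma req_trans v u w : req u v -> req v w -> req u w. Proof. exact: rst_trans. Qed.

Lemma req_ctx p s u w : req u w -> req (p ++ u ++ s) (p ++ w ++ s).
Proof.
elim=> [u1 w1 H|?|u1 w1 _ IH|u1 v1 w1 _ IH1 _ IH2].
- apply: rst_step; case: H => [a b x c|a b x y bx bY Hxy].
  + rewrite -!catA (catA p a) (catA p a); exact: step_cancel.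
  + by rewrite -!catA (catA p a) (catA p a); apply: step_comm.
- exact: req_refl.
- exact: req_sym.
- exact: req_trans IH1 IH2.
Qed.

Lemma req_cat u u' w w' : req u u' -> req w w' -> req (u ++ w) (u' ++ w').
Proof.
move=> Hu Hw; apply: (@req_trans (u' ++ w)).
  by have := req_ctx [::] w Hu.
by have := req_ctx u' [::] Hw; rewrite !cats0.
Qed.

Lemma req_catl u w w' : req w w' -> req (u ++ w) (u ++ w').
Proof. by apply: req_cat; exact: req_refl. Qed.

Lemma req_catr u u' w : req u u' -> req (u ++ w) (u' ++ w).
Proof. by move=> H; apply: req_cat H _; exact: req_refl. Qed.

Lemma req_cons l w w' : req w w' -> req (l :: w) (l :: w').
Proof. exact: (@req_catl [:: l]). Qed.

Lemma req_cancel l w : req (l :: linv l :: w) w.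
Proof. by case: l => x b; apply: rst_step; exact: (@step_cancel _ _ [::]). Qed.

Lemma req_cancel' l w : req (linv l :: l :: w) w.
Proof. by rewrite -{2}[l]linvK; exact: req_cancel. Qed.

Lemma req_swap l k w : e l.1 k.1 -> req (l :: k :: w) (k :: l :: w).
Proof. by case: l k => [x b] [y c] /= H; apply: rst_step; apply: (@step_comm _ _ [::]). Qed.

Lemma req_mulwV w : req (w ++ winv w) [::].
Proof.
elim: w => [|l w IH]; first exact: req_refl.
rewrite winv_cons catA.
apply: (@req_trans ([:: l] ++ [::] ++ [:: linv l])); last exact: req_cancel.
by rewrite -catA -cat1s -catA (catA w); exact: req_ctx.
Qed.

Lemma req_mulVw w : req (winv w ++ w) [::].
Proof. by have := req_mulwV (winv w); rewrite winvK. Qed.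

Lemma req_canl u w : req (winv u ++ u ++ w) w.
Proof. by rewrite catA; have := req_catr w (req_mulVw u). Qed.

Lemma req_canlV u w : req (u ++ winv u ++ w) w.
Proof. by rewrite catA; have := req_catr w (req_mulwV u). Qed.

Lemma req_canr u w : req (w ++ u ++ winv u) w.
Proof. by have := req_catl w (req_mulwV u); rewrite cats0. Qed.

Lemma req_canrV u w : req (w ++ winv u ++ u) w.
Proof. by have := req_catl w (req_mulVw u); rewrite cats0. Qed.

Lemma req_lreg u w w' : req (u ++ w) (u ++ w') -> req w w'.
Proof.
move=> H; apply: req_trans (req_sym (req_canl u w)) _.
exact: req_trans (req_catl _ H) (req_canl u w').
Qed.

Lemma req_rreg u w w' : req (w ++ u) (w' ++ u) -> req w w'.
Proof.
move=> H; apply: req_trans (req_sym (req_canr u w)) _.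
by apply: req_trans (req_canr u w'); rewrite !catA; apply: req_catr.
Qed.

Lemma req_winv u w : req u w -> req (winv u) (winv w).
Proof.
move=> H; apply: (@req_lreg u); apply: req_trans (req_mulwV u) _.
apply: req_sym; exact: req_trans (req_catr _ H) (req_mulwV w).
Qed.

Lemma req_divE u w : req u w <-> req (u ++ winv w) [::].
Proof.
split=> H; first exact: req_trans (req_catr _ H) (req_mulwV w).
by apply: (@req_rreg (winv w)); apply: req_trans H (req_sym (req_mulwV w)).
Qed.

Definition pr x y w : word V := [seq l <- w | (l.1 == x) || (l.1 == y)].

(* Two words denote the same trace iff they have the same projections to all
   pairs of dependent letters (Cori-Perrin); this is taken as the definition. *)
Definition teq u w := forall x y, ~~ e x y -> pr x y u = pr x y w.

Lemma pr_cat x y u w : pr x y (u ++ w) = pr x y u ++ pr x y w.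
Proof. exact: filter_cat. Qed.

Lemma teq_refl w : teq w w. Proof. by []. Qed.
Lemma teq_sym u w : teq u w -> teq w u. Proof. by move=> H x y /H. Qed.
Lemma teq_trans v u w : teq u v -> teq v w -> teq u w.
Proof. by move=> H1 H2 x y H; rewrite H1 ?H2. Qed.

Lemma teq_cat u u' w w' : teq u u' -> teq w w' -> teq (u ++ w) (u' ++ w').
Proof. by move=> H1 H2 x y H; rewrite !pr_cat H1 ?H2. Qed.

Lemma teq_lreg u w w' : teq (u ++ w) (u ++ w') -> teq w w'.
Proof. by move=> H x y /H; rewrite !pr_cat => /eqP; rewrite eqseq_cat // => /andP[_ /eqP]. Qed.

Lemma teq_cons l w w' : teq (l :: w) (l :: w') <-> teq w w'.
Proof. by split=> [|H]; [exact: (@teq_lreg [:: l]) | exact: (@teq_cat [:: l] [:: l])]. Qed.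

Lemma teq_swap l k w : e l.1 k.1 -> teq (l :: k :: w) (k :: l :: w).
Proof.
move=> H x y nxy; rewrite /pr /=.
case: ifP => // /orP Hl; case: ifP => // /orP Hk; exfalso.
case: Hl Hk => /eqP Hl [] /eqP Hk; move: H nxy; rewrite Hl Hk ?e_irr //.
  by move->.
by rewrite e_sym => ->.
Qed.

Lemma teq_winv u w : teq u w -> teq (winv u) (winv w).
Proof. by move=> H x y /H; rewrite /pr !winvE !filter_rev !filter_map => ->. Qed.

(** Left division by a letter in the trace monoid; [None] means that the first [l] is absent or
    blocked by a letter in front of it that does not commute with it. *)
Fixpoint rm l w : option (word V) :=
  if w is k :: w' then
    if k == l then Some w'
    else if e l.1 k.1 then omap (cons k) (rm l w') else None
  else None.

Lemma rm_cat l u w :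
  rm l (u ++ w) = if rm l u is Some u' then Some (u' ++ w)
                  else if all (fun k => e l.1 k.1) u then omap (cat u) (rm l w) else None.
Proof.
elim: u => [|k u IH] /=; first by case: (rm l w).
case: eqP => // _; case: ifP => //= _; rewrite IH.
by case: (rm l u) => //=; case: ifP => //; case: (rm l w).
Qed.

Lemma rm_teq l w w' : rm l w = Some w' -> teq w (l :: w').
Proof.
elim: w w' => //= k w IH w'; case: eqP => [-> [->] //|_].
case: ifP => // H; case E: (rm l w) => [v|] //= [<-].
apply: (@teq_trans (k :: l :: v)); first by apply/teq_cons/IH.
by apply: teq_swap; rewrite e_sym.
Qed.

Lemma rm_req l w w' : rm l w = Some w' -> req w (l :: w').
Proof.
elim: w w' => //= k w IH w'; case: eqP => [-> [->]|_]; first exact: req_refl.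
case: ifP => // H; case E: (rm l w) => [v|] //= [<-].
apply: (@req_trans (k :: l :: v)); first by apply/req_cons/IH.
by apply: req_swap; rewrite e_sym.
Qed.

Lemma rm_perm l w w' : rm l w = Some w' -> perm_eq w (l :: w').
Proof.
elim: w w' => //= k w IH w'; case: eqP => [-> [->] //|_].
case: ifP => // H; case E: (rm l w) => [v|] //= [<-].
apply: (@perm_trans _ (k :: l :: v)); first by rewrite perm_cons IH.
by rewrite (perm_catCA [:: k] [:: l]).
Qed.

(** For each [z] not commuting with [l], the projection of [w] to [l.1] and [z] begins with [l], so
    nothing in front of the first [l] of [w] can block it. *)
Lemma teq_rm l w w' : teq w (l :: w') -> exists2 v, rm l w = Some v & teq v w'.
Proof.
move=> H; suff [v Hv] : exists v, rm l w = Some v.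
  by exists v => //; apply/(@teq_cons l); apply: teq_trans H; apply/teq_sym/rm_teq.
have {H}: forall z, ~~ e l.1 z -> ohead (pr l.1 z w) = Some l.
  by move=> z /H ->; rewrite /pr /= eqxx.
elim: w => [/(_ l.1)|k w IH H]; first by rewrite e_irr => /(_ isT).
rewrite /=; case: (k =P l) => [_|Hkl]; first by exists w.
case: ifP => He.
  case: IH => [z Hz|v ->]; last by exists (k :: v).
  rewrite -(H _ Hz) /pr /= ifF //; apply/negP => /orP[] /eqP E.
    by rewrite E e_irr in He.
  by rewrite -E He in Hz.
by move: (H k.1 (negbT He)); rewrite /pr /= eqxx orbT /= => -[].
Qed.

Lemma teq_nil w : teq w [::] -> w = [::].
Proof. by case: w => // l w /(_ l.1 l.1); rewrite e_irr /pr /= eqxx => /(_ isT). Qed.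

Lemma teq_req u w : teq u w -> req u w.
Proof.
elim: u w => [|l u IH] w; first by move/teq_sym/teq_nil->; exact: req_refl.
move/teq_sym/teq_rm => [v Hv /teq_sym/IH Huv].
exact: req_trans (req_cons _ Huv) (req_sym (rm_req Hv)).
Qed.

Lemma teq_perm u w : teq u w -> perm_eq u w.
Proof.
elim: u w => [|l u IH] w; first by move/teq_sym/teq_nil->.
move/teq_sym/teq_rm => [v Hv /teq_sym/IH Huv].
by rewrite perm_sym; apply: perm_trans (rm_perm Hv) _; rewrite perm_cons perm_sym.
Qed.

Lemma teq_size u w : teq u w -> size u = size w.
Proof. by move/teq_perm/perm_size. Qed.

Lemma teq_all (a : pred (V * bool)) u w : teq u w -> all a u = all a w.
Proof. by move/teq_perm/perm_all. Qed.

(** * Reduced words and normal forms *)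

Definition reduced w := forall u1 l u2, ~ teq w (u1 ++ l :: linv l :: u2).

Lemma reduced_teq u w : teq u w -> reduced u -> reduced w.
Proof. by move=> H R u1 l u2 /(teq_trans H)/R. Qed.

Lemma reduced_catl u w : reduced (u ++ w) -> reduced u.
Proof.
move=> R u1 l u2 H; apply: (R u1 l (u2 ++ w)).
by have := teq_cat H (teq_refl w); rewrite -catA.
Qed.

Lemma reduced_catr u w : reduced (u ++ w) -> reduced w.
Proof.
move=> R u1 l u2 H; apply: (R (u ++ u1) l u2).
by have := teq_cat (teq_refl u) H; rewrite -catA.
Qed.

Lemma reduced_tail l w : reduced (l :: w) -> reduced w.
Proof. exact: (@reduced_catr [:: l]). Qed.

Lemma reduced_nil : reduced [::].
Proof. by move=> [|k u1] l u2 /teq_sym/teq_nil. Qed.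

Lemma reduced1 l : reduced [:: l].
Proof.
by move=> u1 k u2 /teq_size; rewrite size_cat /= !addnS.
Qed.

Lemma reduced_winv w : reduced w -> reduced (winv w).
Proof.
move=> R u1 l u2 /teq_winv; rewrite winvK winv_cat !winv_cons linvK -!catA.
exact: R.
Qed.

(** When [l] is divided out of a word with a cancelling pair, it comes from before the pair, is its
    first letter, or comes from behind it. The outer cases leave a cancelling pair in [w]; the
    middle one brings [linv l] to the front of [w]. *)
Lemma reduced_cons l w : reduced w -> rm (linv l) w = None -> reduced (l :: w).
Proof.
move=> R N u1 k u2 /teq_sym /teq_rm [v]; rewrite rm_cat.
case E1: (rm l u1) => [u1'|].
  by case=> <- /teq_sym; apply: R.
case: ifP => // A1 /=.
case: (k =P l) => [-> [<-] /teq_sym Hw|Hkl].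
  suff : teq w (linv l :: u1 ++ u2) by case/teq_rm => ?; rewrite N.
  apply: teq_trans Hw _; elim: u1 A1 {E1} => //= k1 u1 IH /andP[H1 /IH H2].
  apply: (@teq_trans (k1 :: linv l :: u1 ++ u2)); first exact/teq_cons.
  by apply: teq_swap; rewrite e_sym.
case: ifP => //= Hlk; case: ifP => [/eqP E|_].
  by rewrite -E /= e_irr in Hlk.
rewrite ?Hlk; case E2: (rm l u2) => [u2'|] //= [<-] /teq_sym; exact: R.
Qed.

Lemma reduced_rm_inv l w : reduced (l :: w) -> rm (linv l) w = None.
Proof.
move=> R; case E: (rm (linv l) w) => [v|] //; case: (R [::] l v).
by apply/teq_cons/rm_teq.
Qed.

Definition mulL l w := if rm (linv l) w is Some v then v else l :: w.

Definition norm w := foldr mulL [::] w.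

Lemma reduced_mulL l w : reduced w -> reduced (mulL l w).
Proof.
rewrite /mulL => R; case E: (rm (linv l) w) => [v|]; last exact: reduced_cons.
by have := reduced_teq (rm_teq E) R; exact: reduced_tail.
Qed.

Lemma mulL_teq l u w : teq u w -> teq (mulL l u) (mulL l w).
Proof.
rewrite /mulL => H.
case Eu: (rm (linv l) u) => [u'|].
  have /teq_rm [v -> Hv] : teq w (linv l :: u').
    by apply: teq_trans (rm_teq Eu); apply: teq_sym.
  exact: teq_sym.
case Ew: (rm (linv l) w) => [w'|]; last exact/teq_cons.
by have /teq_rm [v] := teq_trans H (rm_teq Ew); rewrite Eu.
Qed.

Lemma mulL_req l w : req (mulL l w) (l :: w).
Proof.
rewrite /mulL; case E: (rm (linv l) w) => [v|]; last exact: req_refl.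
by apply: req_sym; apply: req_trans (req_cons l (rm_req E)) _; exact: req_cancel.
Qed.

Lemma mulL_cancel l w : reduced w -> teq (mulL l (mulL (linv l) w)) w.
Proof.
rewrite {2}/mulL linvK => R; case E: (rm l w) => [v|].
  rewrite /mulL; case E2: (rm (linv l) v) => [v'|]; last exact/teq_sym/rm_teq.
  case: (R [::] l v'); apply: teq_trans (rm_teq E) _; apply/teq_cons; exact: rm_teq.
by rewrite /mulL /= eqxx.
Qed.

Lemma mulL_comm l k w : e l.1 k.1 ->
  reduced w -> teq (mulL l (mulL k w)) (mulL k (mulL l w)).
Proof.
move=> Hlk R; have Hkl : e k.1 l.1 by rewrite e_sym.
have N1 : (k == linv l) = false.
  by apply/negP => /eqP E; rewrite E /= e_irr in Hlk.
have N2 : (l == linv k) = false.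
  by apply/negP => /eqP E; rewrite E /= e_irr in Hlk.
have N3 : (linv k == linv l) = false.
  by apply/negP => /eqP /(can_inj linvK) E; rewrite E e_irr in Hlk.
have N4 : (linv l == linv k) = false by rewrite eq_sym.
rewrite /mulL; case El: (rm (linv l) w) => [w1|]; case Ek: (rm (linv k) w) => [w2|] /=.
- have : teq (linv l :: w1) (linv k :: w2).
    by apply: teq_trans (rm_teq Ek); apply/teq_sym/rm_teq.
  move/teq_rm => [v] /=; rewrite N4 Hkl; case E1: (rm (linv k) w1) => [v1|] //= [<-].
  by move/teq_sym/teq_rm => [v2 -> H2].
- rewrite N1 Hlk El /=; case E1: (rm (linv k) w1) => [v|] //.
  have : teq w (linv k :: linv l :: v).
    apply: teq_trans (rm_teq El) _; apply: teq_trans (_ : teq _ (linv l :: linv k :: v)) _.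
      by apply/teq_cons/rm_teq.
    exact: teq_swap.
  by case/teq_rm => ?; rewrite Ek.
- rewrite N2 Hkl Ek /=; case E1: (rm (linv l) w2) => [v|] //.
  have : teq w (linv l :: linv k :: v).
    apply: teq_trans (rm_teq Ek) _; apply: teq_trans (_ : teq _ (linv k :: linv l :: v)) _.
      by apply/teq_cons/rm_teq.
    exact: teq_swap.
  by case/teq_rm => ?; rewrite El.
- by rewrite N1 N2 Hlk Hkl El Ek /=; apply: teq_swap.
Qed.

Lemma norm_cons l w : norm (l :: w) = mulL l (norm w).
Proof. by []. Qed.

Lemma reduced_norm w : reduced (norm w).
Proof. by elim: w => [|l w IH]; [exact: reduced_nil | exact: reduced_mulL]. Qed.

Lemma norm_req w : req (norm w) w.
Proof.
elim: w => [|l w IH]; first exact: req_refl.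
exact: req_trans (mulL_req l _) (req_cons l IH).
Qed.

Lemma norm_teq_catl u w w' : teq (norm w) (norm w') -> teq (norm (u ++ w)) (norm (u ++ w')).
Proof. by elim: u => //= l u IH /IH; apply: mulL_teq. Qed.

(** Van der Waerden's argument: by [mulL_cancel] and [mulL_comm] the letters act on reduced traces
    compatibly with the relations, so equal group elements send the empty word to the same trace. *)
Lemma norm_sound u w : req u w -> teq (norm u) (norm w).
Proof.
elim=> [u1 w1 H|?|u1 w1 _ IH|u1 v1 w1 _ IH1 _ IH2] //.
- case: H => [a b x c|a b x y bx bY Hxy]; apply: norm_teq_catl => /=.
  + by have := @mulL_cancel (x, c) (norm b) (@reduced_norm b).
  + exact: mulL_comm (@reduced_norm b).
- exact: teq_sym.
- exact: teq_trans IH1 IH2.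
Qed.

Lemma norm_id w : reduced w -> norm w = w.
Proof.
elim: w => //= l w IH R; rewrite IH; last exact: reduced_tail R.
by rewrite /mulL reduced_rm_inv.
Qed.

Lemma reduced_req_teq u w : reduced u -> reduced w -> req u w -> teq u w.
Proof. by move=> Ru Rw /norm_sound; rewrite !norm_id. Qed.

Lemma norm_teq u w : reduced u -> req u w -> teq u (norm w).
Proof.
move=> R H; apply: reduced_req_teq R (@reduced_norm w) _.
exact: req_trans H (req_sym (norm_req w)).
Qed.

Definition reqb u w := norm (u ++ winv w) == [::].

Lemma reqP u w : reflect (req u w) (reqb u w).
Proof.
apply: (iffP eqP) => [E|/req_divE/norm_sound/teq_nil //].
by apply/req_divE; apply: req_trans (req_sym (norm_req _)) _; rewrite E; exact: req_refl.
Qed.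

Lemma norm_nil w : req w [::] <-> norm w = [::].
Proof.
split=> [/norm_sound/teq_nil //|E].
by apply: req_trans (req_sym (norm_req _)) _; rewrite E; exact: req_refl.
Qed.

Lemma perm_mulL l w : {v | perm_eq (l :: w) (v ++ mulL l w)}.
Proof.
rewrite /mulL; case E: (rm (linv l) w) => [v|]; last by exists [::].
by exists [:: l; linv l]; rewrite /= perm_cons; exact: rm_perm.
Qed.

Lemma count_norm (a : pred (V * bool)) w : count a (norm w) <= count a w.
Proof.
elim: w => //= l w IH; have [v /permP /(_ a)] := perm_mulL l (norm w).
rewrite count_cat /= => H; rewrite -/(norm w); move: H IH; lia.
Qed.

Lemma all_norm (a : pred (V * bool)) w : all a w -> all a (norm w).
Proof.
elim: w => //= l w IH /andP[Hl /IH H]; have [v /(perm_all a)] := perm_mulL l (norm w).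
by rewrite all_cat /= Hl H => /esym /andP[].
Qed.

Lemma size_norm w : size (norm w) <= size w.
Proof. by have := count_norm predT w; rewrite !count_predT. Qed.

Lemma size_norm_req u w : req u w -> size (norm w) = size (norm u).
Proof. by move/norm_sound/teq_size. Qed.

Lemma size_reduced w : size w <= size (norm w) -> reduced w.
Proof.
move=> H u1 l u2 Ht; have /size_norm_req E : req w (u1 ++ u2).
  by apply: req_trans (teq_req Ht) _; apply: req_catl; exact: req_cancel.
have := size_norm (u1 ++ u2); move: H (teq_size Ht); rewrite -E !size_cat /=; lia.
Qed.

(** Letters of [u] are moved onto [w] from the right. If an earlier letter [k] cancels past [l],
    then [k] and [l] commute, so [k] can still be brought to the end of [u]. *)
Lemma reduced_cat u w : reduced u -> reduced w ->
  reduced (u ++ w) \/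
  exists l u' w', teq u (u' ++ [:: l]) /\ teq w (linv l :: w').
Proof.
elim/last_ind: u w => [|u l IH] w Ru Rw; first by left.
rewrite -cats1 in Ru *.
case E: (rm (linv l) w) => [w'|].
  by right; exists l, u, w'; split=> //; exact: rm_teq.
rewrite -catA /=; case: (IH (l :: w)) => [||R|[k [u' [w' [Hu]]]]].
- exact: reduced_catl Ru.
- exact: reduced_cons.
- by left.
move/teq_rm => [v] /=; case: eqP => [El|_].
  case: (Ru u' k [::]); apply: teq_trans (teq_cat Hu (teq_refl [:: l])) _.
  by rewrite El -catA.
case: ifP => // Hkl; case E2: (rm (linv k) w) => [v'|] //= _ _; right.
exists k, (u' ++ [:: l]), v'; split; last exact: rm_teq.
apply: teq_trans (teq_cat Hu (teq_refl [:: l])) _.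
by rewrite -!catA; apply: teq_cat => //; exact: teq_swap.
Qed.

(** * Commutation, conjugation and leading exponents *)

Definition com u w := req (u ++ w) (w ++ u).

Lemma com_refl u : com u u. Proof. exact: req_refl. Qed.
Lemma com_sym u w : com u w -> com w u. Proof. exact: req_sym. Qed.

Lemma com_req u u' w w' : req u u' -> req w w' -> com u w -> com u' w'.
Proof.
move=> Hu Hw H; apply: req_trans (req_cat (req_sym Hu) (req_sym Hw)) _.
exact: req_trans H (req_cat Hw Hu).
Qed.

Lemma com_nil u : com u [::].
Proof. by rewrite /com cats0; exact: req_refl. Qed.

Lemma com_req1 u w : req w [::] -> com u w.
Proof. by move=> H; exact: com_req (req_refl u) (req_sym H) (com_nil u). Qed.

Lemma com_cat u w w' : com u w -> com u w' -> com u (w ++ w').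
Proof.
move=> H H'; rewrite /com catA; apply: req_trans (req_catr w' H) _.
by rewrite -!catA; apply: req_catl.
Qed.

Lemma com_winv u w : com u w -> com u (winv w).
Proof.
move=> H; apply: (@req_lreg w); apply: (@req_rreg w).
apply: (@req_trans (w ++ u)).
  by rewrite -!catA; have := req_canrV w (w ++ u); rewrite -catA.
apply: req_trans (req_sym H) _; rewrite -!catA.
exact: req_sym (req_canlV _ _).
Qed.

Lemma com_winvE u w : com u (winv w) <-> com u w.
Proof. by split=> /com_winv; rewrite ?winvK. Qed.

Lemma req_wconj g u u' : req u u' -> req (wconj g u) (wconj g u').
Proof. exact: req_ctx. Qed.

Lemma req_wconjl g g' u : req g g' -> req (wconj g u) (wconj g' u).
Proof. by move=> H; apply: req_cat (req_winv H) (req_catl _ H). Qed.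

Lemma wconj_cat g h u : wconj (g ++ h) u = wconj h (wconj g u).
Proof. by rewrite /wconj winv_cat -!catA. Qed.

Lemma wconj_mul g u w : req (wconj g (u ++ w)) (wconj g u ++ wconj g w).
Proof.
rewrite /wconj -!catA; apply: req_catl; apply: req_catl.
exact: req_sym (req_canlV _ _).
Qed.

Lemma wconjK g u : req (wconj (winv g) (wconj g u)) u.
Proof.
rewrite /wconj winvK -!catA; apply: req_trans (req_canlV _ _) _; exact: req_canr.
Qed.

Lemma wconjVK g u : req (wconj g (wconj (winv g) u)) u.
Proof. by have := wconjK (winv g) u; rewrite winvK. Qed.

Lemma wconj_com g u : com g u -> req (wconj g u) u.
Proof.
by move/req_sym => H; apply: req_trans (req_catl _ H) _; exact: req_canl.
Qed.

Lemma com_wconj g u w : com u w -> com (wconj g u) (wconj g w).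
Proof.
move=> H; apply: req_trans (req_sym (wconj_mul _ _ _)) _.
exact: req_trans (req_wconj g H) (wconj_mul _ _ _).
Qed.

Lemma com_wconjE g u w : com (wconj g u) (wconj g w) <-> com u w.
Proof.
split; last exact: com_wconj.
by move/(com_wconj (winv g)); apply: com_req; exact: wconjK.
Qed.

Lemma com_wconjr g u w : com (wconj g u) w <-> com u (wconj (winv g) w).
Proof.
rewrite -(com_wconjE g u); split; apply: com_req; try exact: req_refl.
  exact: req_sym (wconjVK _ _).
exact: wconjVK.
Qed.

Lemma com_letter l k : (l.1 == k.1) || e l.1 k.1 -> com [:: l] [:: k].
Proof.
case/orP => [/eqP E|H]; last exact: req_swap.
case: l k E => x b [y c] /= <-; case: (b =P c) => [->|/eqP]; first exact: com_refl.
move=> H; have -> : [:: (x, c)] = winv [:: (x, b)] by case: b c H => [] [].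
exact/com_winv/com_refl.
Qed.

Lemma com_words u w :
  (forall l k, l \in u -> k \in w -> (l.1 == k.1) || e l.1 k.1) -> com u w.
Proof.
elim: u => [|l u IH] H; first by apply: com_sym; exact: com_nil.
apply: com_sym; apply: (@com_cat _ [:: l]); last first.
  by apply/com_sym/IH => l' k Hl; apply: H; rewrite in_cons Hl orbT.
have {}H : forall k, k \in w -> (l.1 == k.1) || e l.1 k.1 by move=> k; apply: H; rewrite mem_head.
elim: w H {IH} => [|k w IH] H; first by apply: com_sym; exact: com_nil.
apply: com_sym; apply: (@com_cat _ [:: k]).
  by apply: com_letter; apply: H; rewrite mem_head.
by apply/com_sym/IH => k' Hk; apply: H; rewrite in_cons Hk orbT.
Qed.

Definition star x : pred V := fun y => (y == x) || e x y.

Definition over (A : pred V) w := all (fun l : V * bool => A l.1) w.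

Lemma com_star x b w : over (star x) w -> com [:: (x, b)] w.
Proof.
move/allP => H; apply: com_words => l k; rewrite inE => /eqP-> /H.
by rewrite /star eq_sym.
Qed.

Lemma over_cat A u w : over A (u ++ w) = over A u && over A w.
Proof. exact: all_cat. Qed.

Lemma over_winv A w : over A (winv w) = over A w.
Proof. exact: all_winv. Qed.

Lemma over_norm A w : over A w -> over A (norm w).
Proof. exact: all_norm. Qed.

Lemma over_teq A u w : teq u w -> over A u = over A w.
Proof. exact: teq_all. Qed.

Definition wexp w n : word V := flatten (nseq n w).

Lemma wexpS w n : wexp w n.+1 = w ++ wexp w n.
Proof. by []. Qed.

Lemma wexpSr w n : wexp w n.+1 = wexp w n ++ w.
Proof.
elim: n => [|n IH]; first by rewrite /wexp /= cats0.
by rewrite wexpS {1}IH catA.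
Qed.

Lemma size_wexp w n : size (wexp w n) = n * size w.
Proof. by elim: n => //= n IH; rewrite wexpS size_cat IH mulSn. Qed.

Lemma count_wexp a w n : count a (wexp w n) = n * count a w.
Proof. by elim: n => //= n IH; rewrite wexpS count_cat IH mulSn. Qed.

Lemma over_wexp A w n : over A w -> over A (wexp w n).
Proof. by move=> H; elim: n => //= n IH; rewrite wexpS over_cat H. Qed.

Lemma wexp1 l n : wexp [:: l] n = nseq n l.
Proof. by elim: n => //= n <-. Qed.

Lemma com_wexp u w n : com u w -> com u (wexp w n).
Proof. by move=> H; elim: n => [|n IH]; [exact: com_nil | exact: com_cat]. Qed.

Lemma req_wexp u w n : req u w -> req (wexp u n) (wexp w n).
Proof. by move=> H; elim: n => [|n IH]; [exact: req_refl | exact: req_cat]. Qed.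

Lemma wexp_wconj g u n : req (wexp (wconj g u) n) (wconj g (wexp u n)).
Proof.
elim: n => [|n IH]; first exact: req_sym (req_mulVw g).
rewrite !wexpS; apply: req_trans (req_catl _ IH) _; exact: req_sym (wconj_mul _ _ _).
Qed.

Definition sgl l : int := if l.2 then 1%R else (-1)%R.

(* On a reduced word this is the exponent of the leading [x]-syllable: letters are
   read until the first one outside the star of [x]. *)
Fixpoint escan x w : int :=
  if w is l :: w' then
    if l.1 == x then (sgl l + escan x w')%R
    else if e x l.1 then escan x w' else 0%R
  else 0%R.

Definition ev x w := escan x (norm w).

Lemma escan_swap x l k w : e l.1 k.1 -> escan x (l :: k :: w) = escan x (k :: l :: w).
Proof.
move=> H /=; case: (l.1 =P x) => [El|_]; case: (k.1 =P x) => [Ek|_].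
- by rewrite El Ek e_irr in H.
- by rewrite -El H.
- by rewrite -Ek e_sym H.
- by case: (e x l.1); case: (e x k.1).
Qed.

Lemma escan_cons x l u w : escan x u = escan x w -> escan x (l :: u) = escan x (l :: w).
Proof. by move=> /= ->. Qed.

Lemma escan_rm x l w w' : rm l w = Some w' -> escan x w = escan x (l :: w').
Proof.
elim: w w' => // k w IH w'; rewrite [rm l _]/=; case: eqP => [-> [->] //|_].
case: ifP => // H; case E: (rm l w) => [v|] // -[<-].
rewrite (escan_cons k (IH _ E)); apply: escan_swap; by rewrite e_sym.
Qed.

Lemma escan_teq x u w : teq u w -> escan x u = escan x w.
Proof.
elim: u w => [|l u IH] w; first by move/teq_sym/teq_nil->.
move/teq_sym/teq_rm => [v Hv /teq_sym/IH Huv].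
by rewrite (escan_rm x Hv); exact: escan_cons.
Qed.

Lemma ev_req x u w : req u w -> ev x u = ev x w.
Proof. by move/norm_sound/(escan_teq x). Qed.

Lemma ev_reduced x w : reduced w -> ev x w = escan x w.
Proof. by move=> R; rewrite /ev norm_id. Qed.

Lemma ev_self l w : ev l.1 (l :: w) = (sgl l + ev l.1 w)%R.
Proof.
rewrite /ev norm_cons /mulL; case E: (rm _ _) => [v|]; last by rewrite /= eqxx.
rewrite (escan_rm _ E) /= eqxx addrA -[LHS]add0r; congr (_ + _)%R.
by case: l E => x [].
Qed.

Lemma ev_link x l w : e x l.1 -> ev x (l :: w) = ev x w.
Proof.
move=> H; have N : l.1 == x = false by apply/negP => /eqP E; rewrite E e_irr in H.
rewrite /ev norm_cons /mulL; case E: (rm _ _) => [v|]; last by rewrite /= N H.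
by rewrite (escan_rm _ E) /= N H.
Qed.

(** A non-zero exponent means that an [x] is met before any [y], and this [x] stops the scan for [y]
    while its value is still 0. *)
Lemma escan_excl x y w : ~~ star x y -> escan x w != 0%R -> escan y w = 0%R.
Proof.
rewrite /star negb_or => /andP[Nyx Nxy].
elim: w => //= l w IH; case: (l.1 =P x) => [->|_].
  by rewrite (eq_sym x) (negbTE Nyx) e_sym (negbTE Nxy).
case: ifP => [H /IH ->|]; last by rewrite eqxx.
by rewrite if_same ifF //; apply/negP => /eqP E; rewrite -E H in Nxy.
Qed.

Lemma ev_excl x y w : ~~ star x y -> ev x w != 0%R -> ev y w = 0%R.
Proof. exact: escan_excl. Qed.

Lemma escan_sign x b w : reduced w -> rm (x, ~~ b) w = None ->
  (0 <= sgl (x, b) * escan x w)%R.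
Proof.
elim: w => [|l w IH] R; first by rewrite /= mulr0.
rewrite [rm _ _]/=; case: eqP => // N.
have R' := reduced_tail R; rewrite [escan _ _]/=.
case: (l.1 =P x) => [E _|_].
  have {E N} El : l = (x, b).
    by case: l N E {R} => y c /= N E; subst y; case: c b N {IH} => [] [].
  rewrite El mulrDr; apply: addr_ge0; first by case: (b).
  by apply: IH => //; have := reduced_rm_inv R; rewrite El.
case: ifP => /= H; last by rewrite mulr0.
case E: (rm _ w) => //= _; exact: IH.
Qed.

Lemma ev_lead l w : reduced (l :: w) -> ev l.1 (l :: w) != 0%R.
Proof.
move=> R; rewrite ev_self ev_reduced; last exact: reduced_tail R.
have := escan_sign (reduced_tail R) (reduced_rm_inv R).
by rewrite /sgl /=; case: (l.2); lia.
Qed.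

Lemma escan_size x w : `|escan x w| <= size w.
Proof.
elim: w => //= l w IH; case: ifP => _; first by move: IH; rewrite /sgl; case: (l.2); lia.
by case: ifP => _ //; apply: leq_trans IH _.
Qed.

Lemma ev_size x w : `|ev x w| <= size w.
Proof. exact: leq_trans (escan_size _ _) (size_norm _). Qed.

Lemma ev_ex w : ~ req w [::] -> exists x, ev x w != 0%R.
Proof.
move=> H; case E: (norm w) => [|l v]; first by case: H; apply/norm_nil.
exists l.1; have R := @reduced_norm w; rewrite E in R.
by have := ev_lead R; rewrite (ev_reduced _ R) /ev E.
Qed.

Lemma ev_leading x w : ev x w != 0%R -> exists b v, teq (norm w) ((x, b) :: v).
Proof.
rewrite /ev => H; suff [b [v /rm_teq]] : exists b v, rm (x, b) (norm w) = Some v by exists b, v.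
elim: (norm w) H => //= [[y b] r] IH /=; case: (y =P x) => [->|N].
  by exists b, r; rewrite eqxx.
case: ifP => // H /IH [c [v Hv]]; exists c, ((y, b) :: v).
by rewrite xpair_eqE (introF eqP N) /= ?H Hv.
Qed.

Lemma escan_cat x u w :
  escan x (u ++ w) = if over (star x) u then (escan x u + escan x w)%R else escan x u.
Proof.
elim: u => [|l u IH]; first by rewrite /= add0r.
have -> : over (star x) (l :: u) = star x l.1 && over (star x) u by [].
rewrite /= IH /star; case: (l.1 =P x) => [_|_] /=; first by case: ifP => _; rewrite ?addrA.
by case: (e x l.1).
Qed.

(* Behrstock's inequality for the projections to the lines of [x'] and [x^g]. *)
Lemma behrstock x x' g h :
  ~ com (wconj g [:: (x, true)]) [:: (x', true)] ->
  size g < `|ev x' h| -> `|ev x (g ++ h)| <= size g.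
Proof.
move=> N H; rewrite -(ev_req _ (req_catr h (norm_req g))).
apply: leq_trans (size_norm g).
have {}N : ~ com (wconj (norm g) [:: (x, true)]) [:: (x', true)].
  move=> N'; apply: N; apply: com_req N'; last exact: req_refl.
  exact/req_wconjl/norm_req.
have {}H := leq_ltn_trans (size_norm g) H.
have := @reduced_norm g; move: (norm g) N H => {}g; have [n] := ubnP (size g).
elim: n g h => // n IH g h Hn N H R.
(* A last letter of [g] in the star of [x'] can be moved over to [h]: conjugation by it fixes [x'],
   and [ev x' h] changes by at most 1 while [g] loses one letter. *)
have [[y [b [g' [Hx Hg]]]]|NT] :=
  classic (exists y b g', star x' y /\ teq g (g' ++ [:: (y, b)])).
  have Sg : size g = (size g').+1 by rewrite (teq_size Hg) size_cat addn1.
  have E : ev x (g ++ h) = ev x (g' ++ (y, b) :: h).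
    by apply: ev_req; have := req_catr h (teq_req Hg); rewrite -catA.
  rewrite E Sg; apply/leqW/IH; [by rewrite -ltnS -Sg| | |].
  - move=> C; apply: N.
    have C2 : com [:: (y, b)] [:: (x', true)].
      by apply: com_letter; rewrite /= e_sym.
    apply: com_req (com_wconj [:: (y, b)] C); last exact: wconj_com C2.
    rewrite -wconj_cat; apply: req_wconjl; exact/req_sym/teq_req.
  - have : `|ev x' ((y, b) :: h) - ev x' h| <= 1.
      move: Hx => /orP[/eqP Ex|Hx]; last by rewrite ev_link //; lia.
      by have := @ev_self (y, b) h; rewrite /= Ex => ->; rewrite /sgl /=; case: b {Hg E}; lia.
    by move: H; rewrite Sg; lia.
  - exact: reduced_catl (reduced_teq Hg R).
have Nz : ev x' h != 0%R by move: H; lia.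
have [b [r Hr]] := ev_leading Nz.
(* A letter of [g] cancelling against [norm h] would lie in the star of [x'], because [norm h]
   starts with an [x']-letter. *)
have Rgh : reduced (g ++ norm h).
  case: (reduced_cat R (@reduced_norm h)) => // -[l [g' [w' [Hg Hw]]]].
  case: NT; exists l.1, l.2, g'; split; last by case: l Hg {Hw}.
  have /teq_rm [s] := teq_trans (teq_sym Hr) Hw.
  rewrite /= /star; case: eqP => [[<- _]|_]; first by rewrite eqxx.
  by case: ifP => //; rewrite e_sym => ->; rewrite orbT.
have -> : ev x (g ++ h) = escan x (g ++ norm h).
  by rewrite -(ev_reduced _ Rgh); apply/ev_req/req_catl/req_sym/norm_req.
rewrite escan_cat; case: ifP => Hs; last exact: escan_size.
(* Here [g] centralizes [x], so [x] and [x'] do not commute, and the leading [x'] makes the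
   contribution of [h] vanish. *)
have NS : ~~ star x' x.
  apply/negP => Hv; apply: N; apply: (@com_req [:: (x, true)]).
  - by apply/req_sym/wconj_com/com_sym/com_star.
  - exact: req_refl.
  - by apply: com_letter; rewrite /= e_sym.
by rewrite (ev_excl NS Nz : escan _ (norm h) = _) addr0; exact: escan_size.
Qed.

(** * Centralizers *)

Definition power_reduced w := forall n, reduced (wexp w n).

(* Once [h w^n] has stopped shrinking relative to [w^n], the relation
   [h w = w h] holds already between traces. *)
Lemma com_trace h w : power_reduced w -> com h w ->
  exists n X, [/\ reduced X, req X (h ++ wexp w n) & teq (X ++ w) (w ++ X)].
Proof.
move=> P C; pose f n := size (norm (h ++ wexp w n)).
have [[n Hn]|N] := classic (exists n, f n + size w <= f n.+1).
  exists n, (norm (h ++ wexp w n)).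
  have HX := norm_req (h ++ wexp w n); set X := norm _ in HX *.
  have E1 : req (X ++ w) (h ++ wexp w n.+1).
    by rewrite wexpSr catA; apply: req_catr.
  have E2 : req (w ++ X) (h ++ wexp w n.+1).
    apply: req_trans (req_catl w HX) _; rewrite wexpS !catA.
    exact/req_catr/req_sym.
  split; [exact: reduced_norm | by [] |].
  apply: reduced_req_teq; last exact: req_trans E1 (req_sym E2).
    apply: size_reduced; rewrite -(size_norm_req E1) size_cat; exact: Hn.
  apply: size_reduced; rewrite -(size_norm_req E2) size_cat addnC; exact: Hn.
(* If each further [w] lengthens the normal form by less than [size w], the bounds [L] and [U]
   contradict each other once [n] exceeds [2 * size h]. *)
have L n : n * size w <= size h + f n.
  rewrite -size_wexp -(norm_id (P n)).
  rewrite (size_norm_req (req_canl h (wexp w n))).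
  rewrite (size_norm_req (req_catl (winv h) (norm_req (h ++ wexp w n)))).
  by apply: leq_trans (size_norm _) _; rewrite size_cat size_winv.
have U n : f n + n <= size h + n * size w.
  elim: n => [|n IH]; first by rewrite /f /wexp /= cats0 !addn0 size_norm.
  have : ~ (f n + size w <= f n.+1) by move=> H; apply: N; exists n.
  by move: IH; rewrite mulSn; lia.
by have := L (2 * size h).+1; have := U (2 * size h).+1; lia.
Qed.

Lemma comm_wexp u w n : u ++ w = w ++ u -> u ++ wexp w n = wexp w n ++ u.
Proof.
move=> H; elim: n => [|n IH]; first by rewrite /wexp /= cats0.
by rewrite wexpS -catA -IH !catA H.
Qed.

Lemma comm_prefix u w n : u ++ w = w ++ u -> w != [::] -> size u <= n ->
  u = take (size u) (wexp w n).
Proof.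
move=> /comm_wexp-/(_ n) H Nw Hn.
have : take (size u) (u ++ wexp w n) = take (size u) (wexp w n ++ u) by rewrite H.
rewrite take_size_cat // takel_cat // size_wexp.
by apply: leq_trans Hn _; rewrite leq_pmulr // lt0n size_eq0.
Qed.

(** These are literal equalities of words: both products commute with [v], so they are prefixes of
    equal length of one power of [v]. *)
Lemma comm_trans v u w : v != [::] -> u ++ v = v ++ u -> w ++ v = v ++ w -> u ++ w = w ++ u.
Proof.
move=> N Hu Hw.
have H1 : (u ++ w) ++ v = v ++ (u ++ w) by rewrite -catA Hw catA Hu catA.
have H2 : (w ++ u) ++ v = v ++ (w ++ u) by rewrite -catA Hu catA Hw catA.
rewrite (comm_prefix H1 N (leqnn _)) (comm_prefix H2 N (leqnn _)).
by rewrite !size_cat addnC.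
Qed.

Lemma comm_all (a : pred (V * bool)) u w : w != [::] -> u ++ w = w ++ u -> all a w -> all a u.
Proof.
move=> N H A; rewrite (comm_prefix H N (leqnn _)).
apply/allP => l /mem_take /flattenP [s].
by rewrite mem_nseq => /andP[_ /eqP->] /(allP A).
Qed.

Definition supp w : {set V} := [set x | x \in map fst w].

Lemma mem_supp l w : l \in w -> l.1 \in supp w.
Proof. by move=> H; rewrite inE map_f. Qed.

Lemma suppP x w : reflect (exists b, (x, b) \in w) (x \in supp w).
Proof.
rewrite inE; apply: (iffP mapP) => [[[y b] H ->]|[b H]]; first by exists b.
by exists (x, b).
Qed.

Lemma over_supp w : over (mem (supp w)) w.
Proof. by apply/allP => l; exact: mem_supp. Qed.

Lemma overP (A : pred V) w : over A w <-> forall x, x \in supp w -> A x.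
Proof.
split=> [/allP H x /suppP [b /H //]|H]; apply/allP => l /mem_supp; exact: H.
Qed.

Lemma over_sub (A B : pred V) w : (forall x, A x -> B x) -> over A w -> over B w.
Proof. by move=> H; apply: sub_all => l; exact: H. Qed.

Lemma supp0 w : supp w = set0 -> w = [::].
Proof. by case: w => // l w /setP /(_ l.1); rewrite !inE /= eqxx. Qed.

Definition link (S : {set V}) : pred V := fun y => [forall x in S, e x y].

Lemma linkP (S : {set V}) y x : link S y -> x \in S -> e x y.
Proof. by move/forall_inP; apply. Qed.

Lemma link_disj (S : {set V}) x : x \in S -> ~ link S x.
Proof. by move=> H /linkP /(_ H); rewrite e_irr. Qed.

Lemma com_link (S : {set V}) u w : over (mem S) u -> over (link S) w -> com u w.
Proof.
move=> /allP Hu /allP Hw; apply: com_words => l k /Hu Hl /Hw /linkP /(_ Hl) ->.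
exact: orbT.
Qed.

(** If [x] is outside [supp w] and some [y] in [supp w] does not commute with it, the projection of
    [w] to [y] and [x] is a non-empty word in [y] alone. The projection of [X] commutes with it as a
    word, so it cannot contain [x]. *)
Lemma comm_supp X w x : teq (X ++ w) (w ++ X) -> x \in supp X ->
  (x \in supp w) || link (supp w) x.
Proof.
move=> H Hx; rewrite -implyNb; apply/implyP => Nx; apply/forall_inP => y Hy.
apply: contraT => Nxy.
have := H y x Nxy; rewrite !pr_cat => Hc.
have Hall : all (fun l => l.1 != x) (pr y x w).
  apply/allP => l; rewrite mem_filter => /andP[_ Hl]; apply: contra Nx => /eqP <-.
  exact: mem_supp.
have Nn : pr y x w != [::].
  case/suppP: Hy => b Hb; apply/eqP => E.
  have : (y, b) \in pr y x w by rewrite mem_filter /= eqxx.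
  by rewrite E.
case/suppP: Hx => b Hb; have /allP /(_ (x, b)) := comm_all Nn Hc Hall.
by rewrite mem_filter /= eqxx orbT Hb => /(_ isT).
Qed.

Lemma over_req A u w : req u w -> over A w -> over A (norm u).
Proof. by move/norm_sound/(over_teq A) ->; exact: over_norm. Qed.

Lemma power_reduced1 l : power_reduced [:: l].
Proof.
elim=> [|n IH]; first exact: reduced_nil.
rewrite wexpS /=; apply: reduced_cons => //.
by rewrite wexp1; case: n {IH} => //= n; rewrite eq_sym linv_neq e_irr.
Qed.

Lemma supp1 x b : supp [:: (x, b)] = [set x].
Proof. by apply/setP => y; rewrite !inE. Qed.

Lemma link1 x y : link [set x] y = e x y.
Proof.
apply/forall_inP/idP => [H|H z]; first by apply: H; rewrite inE.
by rewrite inE => /eqP->.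
Qed.

Lemma com_star_norm x b h : com h [:: (x, b)] -> over (star x) (norm h).
Proof.
case/(com_trace (@power_reduced1 (x, b))) => n [X [_ HX /comm_supp HS]].
have {}HS : over (star x) X.
  by apply/overP => y /HS; rewrite supp1 inE link1.
apply: (@over_req _ _ (X ++ winv (wexp [:: (x, b)] n))).
  apply: req_sym; apply: req_trans (req_catr _ HX) _; rewrite -catA; exact: req_canr.
by rewrite over_cat HS over_winv wexp1 /over all_nseq /star eqxx orbT.
Qed.

Lemma star_norm_com x b h : over (star x) (norm h) -> com h [:: (x, b)].
Proof.
move/(com_star b)/com_sym; apply: com_req; [exact: norm_req | exact: req_refl].
Qed.

Lemma ev_nonstar x y b h : ~~ star x y -> ev y h != 0%R -> ~ com h [:: (x, b)].
Proof.
move=> N; rewrite /ev => Hy /com_star_norm; elim: (norm h) Hy => //= l w IH.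
case: (l.1 =P y) => [->|_]; first by rewrite (negbTE N).
by case: ifP => // _ /IH H /andP[_ /H].
Qed.

Lemma reduced_rcons w l : reduced w -> reduced (w ++ [:: l]) \/
  exists w', teq w (w' ++ [:: linv l]).
Proof.
move=> R; case: (reduced_cat R (@reduced1 l)) => [|[k [w' [v [Hw]]]]]; first by left.
move/teq_rm => [s] /=; case: eqP => [->|_].
  by move=> _ _; right; exists w'; rewrite linvK.
by case: ifP.
Qed.

(** [norm h] contains a letter outside the star of [x]; an [x] added or cancelled at the right end
    lies behind it and is never reached by the scan. *)
Lemma ev_rcons x b h : ~ com h [:: (x, true)] -> ev x (h ++ [:: (x, b)]) = ev x h.
Proof.
move=> N; have NS : over (star x) (norm h) = false.
  by apply/negP => H; apply: N; exact: star_norm_com.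
rewrite -(ev_req _ (req_catr _ (norm_req h))).
case: (reduced_rcons (x, b) (@reduced_norm h)) => [R|[w Hw]].
  by rewrite ev_reduced // escan_cat NS.
have NS' : over (star x) w = false.
  have Sx : over (star x) [:: linv (x, b)] by rewrite /over /= /star eqxx.
  by move: NS; rewrite (over_teq _ Hw) over_cat Sx andbT.
have E : req (norm h ++ [:: (x, b)]) w.
  apply: req_trans (req_catr _ (teq_req Hw)) _; rewrite -catA.
  by have := req_catl w (req_cancel' (x, b) [::]); rewrite cats0.
rewrite (ev_req x E) /ev (escan_teq _ Hw) escan_cat NS'.
rewrite norm_id //; exact: reduced_catl (reduced_teq Hw (@reduced_norm h)).
Qed.

Lemma ev_nseq x n h : ev x (nseq n (x, true) ++ h) = (n%:Z + ev x h)%R.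
Proof.
elim: n => [|n IH]; first by rewrite add0r.
have := ev_self (x, true) (nseq n (x, true) ++ h); rewrite /= IH => ->.
by rewrite /sgl /=; lia.
Qed.

(** Conjugation by the inverse puts the power of [x] on the left of [h], where it adds [n]; the
    inverse power on the right does not count, by [ev_rcons]. *)
Lemma ev_conj_nseq x n h : ~ com h [:: (x, true)] -> `|ev x h| < n ->
  ev x (wconj (winv (nseq n (x, true))) h) != 0%R.
Proof.
move=> N Hn; rewrite /wconj winvK ev_nseq.
have -> : ev x (h ++ winv (nseq n (x, true))) = ev x h.
  elim: n {Hn} => [|n IH]; first by rewrite cats0.
  have -> : winv (nseq n.+1 (x, true)) = winv (nseq n (x, true)) ++ [:: (x, false)].
    by rewrite /= winv_cons.
  rewrite catA ev_rcons // => C; apply: N.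
  have Cx : com [:: (x, true)] (nseq n (x, true)).
    by rewrite -wexp1; apply: com_wexp; exact: com_refl.
  apply: com_req (com_sym (com_cat (com_sym C) Cx)); last exact: req_refl.
  rewrite -catA; exact: req_canrV.
by move: Hn; lia.
Qed.

Lemma teq_move l u s : over (e l.1) u -> teq (l :: u ++ s) (u ++ l :: s).
Proof.
elim: u => //= k u IH /andP[H1 /IH H2].
apply: (@teq_trans (k :: l :: u ++ s)); first exact: teq_swap.
exact/teq_cons.
Qed.

Definition wsub (A : pred V) w : word V := [seq l <- w | A l.1].

Lemma over_wsub A w : over A (wsub A w).
Proof. exact: filter_all. Qed.

Lemma mem_wsub A l w : (l \in wsub A w) = A l.1 && (l \in w).
Proof. exact: mem_filter. Qed.

Lemma teq_split (A : pred V) w :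
  (forall x y, x \in supp w -> y \in supp w -> A x -> ~~ A y -> e x y) ->
  teq w (wsub A w ++ wsub (predC A) w).
Proof.
elim: w => // l w IH H; rewrite /wsub /=.
have {}IH : teq w (wsub A w ++ wsub (predC A) w).
  apply: IH => x y /suppP [b Hb] /suppP [c Hc].
  by apply: H; apply/suppP; [exists b | exists c]; rewrite in_cons ?Hb ?Hc orbT.
case: ifP => HA /=; first exact/teq_cons.
apply: (@teq_trans (l :: (wsub A w ++ wsub (predC A) w))); first exact/teq_cons.
apply: teq_move; apply/allP => k; rewrite mem_wsub => /andP[Hk Hkw].
rewrite e_sym; apply: H; rewrite ?HA //.
  by apply: mem_supp; rewrite in_cons Hkw orbT.
by apply: mem_supp; rewrite mem_head.
Qed.

Lemma supp_wsub (A : pred V) w x : (x \in supp (wsub A w)) = A x && (x \in supp w).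
Proof.
apply/suppP/andP => [[b]|[HA /suppP[b Hb]]].
  by rewrite mem_wsub => /andP[-> Hb]; split=> //; apply/suppP; exists b.
by exists b; rewrite mem_wsub HA.
Qed.

Lemma wsub_wexp A w n : wsub A (wexp w n) = wexp (wsub A w) n.
Proof. by elim: n => //= n IH; rewrite !wexpS -IH /wsub filter_cat. Qed.

Lemma supp_wexp w n x : x \in supp (wexp w n) -> x \in supp w.
Proof.
elim: n => [|n IH]; first by rewrite inE.
case/suppP => b; rewrite wexpS mem_cat => /orP[H|H]; first exact: (mem_supp H).
by apply: IH; exact: (mem_supp H).
Qed.

Lemma power_reduced_wsub (A : pred V) w : power_reduced w ->
  (forall x y, x \in supp w -> y \in supp w -> A x -> ~~ A y -> e x y) ->
  power_reduced (wsub A w).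
Proof.
move=> P H n; rewrite -wsub_wexp; apply: (@reduced_catl _ (wsub (predC A) (wexp w n))).
apply: reduced_teq (P n); apply: teq_split => x y /supp_wexp Hx /supp_wexp Hy.
exact: H.
Qed.

(** Letters of [w] in [A] commute with those outside, so each projection of [wsub A w] to a
    dependent pair is that of [w] or empty. *)
Lemma comm_wsub (A : pred V) X w :
  (forall x y, x \in supp w -> y \in supp w -> A x -> ~~ A y -> e x y) ->
  teq (X ++ w) (w ++ X) -> teq (X ++ wsub A w) (wsub A w ++ X).
Proof.
move=> HA H x y Nxy; rewrite !pr_cat.
have [E|E] : pr x y (wsub A w) = pr x y w \/ pr x y (wsub A w) = [::].
- have [/hasP [l Hl]|/hasPn Hn] := boolP (has (fun l => A l.1) (pr x y w)).
    move=> Al; left; rewrite /pr /wsub -filter_predI; apply: eq_in_filter => k Hk /=.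
    case Hkxy: ((k.1 == x) || (k.1 == y)) => //=.
    apply: contraT => NA; move: Hl; rewrite mem_filter => /andP[Hlxy Hl].
    have := HA l.1 k.1 (mem_supp Hl) (mem_supp Hk) Al NA.
    have Nyx : ~~ e y x by rewrite e_sym.
    by case/orP: Hkxy => /eqP->; case/orP: Hlxy => /eqP->;
       rewrite ?e_irr ?(negbTE Nxy) ?(negbTE Nyx).
  right; rewrite /pr /wsub -filter_predI; apply/eqP.
  rewrite -[_ == _]negbK -has_filter; apply/hasPn => l Hl /=.
  apply/negP => /andP[Hxy HAl]; have := Hn l; rewrite mem_filter Hxy Hl => /(_ isT).
  by rewrite HAl.
- by rewrite E; have := H _ _ Nxy; rewrite !pr_cat.
- by rewrite E cats0.
Qed.

Lemma com_wsub (A : pred V) h w : power_reduced w ->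
  (forall x y, x \in supp w -> y \in supp w -> A x -> ~~ A y -> e x y) ->
  com h w -> com h (wsub A w).
Proof.
move=> P HA /(com_trace P) [n [X [_ HX HT]]].
have C1 : com (wsub A w) X by apply/teq_req/teq_sym/comm_wsub.
have C2 : com (wsub A w) (wexp w n).
  by apply/com_wexp/teq_req/teq_sym/comm_wsub.
apply: com_sym; apply: com_req (com_cat C1 (com_winv C2)); first exact: req_refl.
apply: req_trans (req_catr _ HX) _; rewrite -catA; exact: req_canr.
Qed.

(** The trace [X] of [h] times a power of [w] commutes with [w], so by [comm_supp] its letters lie
    in the support of [w] or in its link; the power is then removed again. *)
Lemma centralizer_split h w : power_reduced w -> com h w ->
  exists p q : word V, [/\ req h (p ++ q), over (mem (supp w)) p & over (link (supp w)) q].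
Proof.
move=> P /(com_trace P) [n [X [_ HX HT]]]; pose S := supp w.
have HS x : x \in supp X -> (x \in S) || link S x by apply: comm_supp HT.
pose p := wsub (mem S) X; pose q := wsub (predC (mem S)) X.
have Hl : over (link S) q.
  apply/overP => x; rewrite supp_wsub => /andP[/= N /HS].
  by rewrite (negbTE N).
exists (p ++ winv (wexp w n)), q; split=> //.
  have Cl : com (winv (wexp w n)) q.
    by apply: (com_link (S := S)) => //; rewrite over_winv; apply/over_wexp/over_supp.
  have HXs : teq X (p ++ q).
    apply: teq_split => x y Hx Hy /= Sx NSy.
    by have := HS y Hy; rewrite (negbTE NSy) => /linkP /(_ Sx).
  rewrite -catA; apply: (@req_trans (X ++ winv (wexp w n))).
    apply: req_sym; apply: req_trans (req_catr _ HX) _; rewrite -catA; exact: req_canr.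
  apply: req_trans (req_catr _ (teq_req HXs)) _.
  by rewrite -catA; apply/req_catl/req_sym.
by rewrite over_cat over_wsub over_winv; apply/over_wexp/over_supp.
Qed.

(** In each projection to a dependent pair, the words of [X] and [X'] commute with that of [w],
    hence with each other. Where the word of [w] is empty, so is that of [X], whose letters all come
    from [supp w]. *)
Lemma centralizer_com h h' w : power_reduced w -> com h w -> com h' w ->
  over (mem (supp w)) h -> com h h'.
Proof.
move=> P C C' HS.
have [n [X [RX HX HT]]] := com_trace P C.
have [n' [X' [_ HX' HT']]] := com_trace P C'.
have SX : over (mem (supp w)) X.
  rewrite (over_teq _ (norm_teq RX HX)); apply: over_norm.
  by rewrite over_cat HS over_wexp // over_supp.
have CX : com X X'.
  apply: teq_req => x y Nxy; rewrite !pr_cat.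
  have [E|N] := eqVneq (pr x y w) [::]; last first.
    apply: (comm_trans N); first by have := HT _ _ Nxy; rewrite !pr_cat.
    by have := HT' _ _ Nxy; rewrite !pr_cat.
  suff -> : pr x y X = [::] by rewrite cats0.
  apply/eqP; rewrite -[_ == _]negbK -has_filter; apply/hasPn => l /(allP SX) /suppP [b Hb].
  apply/negP => Hl; have : (l.1, b) \in pr x y w by rewrite mem_filter Hl.
  by rewrite E.
have CwX : com X w by apply: teq_req.
have CwX' : com X' w by apply: teq_req.
have E i Y Y' : req Y (Y' ++ wexp w i) -> req (Y ++ winv (wexp w i)) Y'.
  move=> H; apply: req_trans (req_catr _ H) _; rewrite -catA; exact: req_canr.
have Cww i : com w (winv (wexp w i)) by apply/com_winv/com_wexp/com_refl.
apply: com_req (E _ _ _ HX) (E _ _ _ HX') _.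
apply: com_sym; apply: com_cat; first by apply/com_sym/com_cat => //; apply/com_winv/com_wexp.
apply/com_winv/com_wexp/com_sym/com_cat; [exact: com_sym | exact: Cww].
Qed.

Lemma count_wconj a c w : count a (wconj c w) <= 2 * size c + count a w.
Proof.
rewrite /wconj !count_cat.
have := count_size a c; have := count_size a (winv c); rewrite size_winv; lia.
Qed.

(** A vertex in [w'] but not in [w] would occur at least [n] times in the [n]-th power of [w'], but
    at most [2 * size c] times in the conjugated power of [w]. *)
Lemma power_reduced_conj_supp c w w' : power_reduced w -> power_reduced w' ->
  req w' (wconj c w) -> supp w' = supp w.
Proof.
suff main c' u u' : power_reduced u -> power_reduced u' -> req u' (wconj c' u) ->
    supp u' \subset supp u.
  move=> P P' H; apply/eqP; rewrite eqEsubset (main c) //= (main (winv c)) //.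
  apply: req_sym; apply: req_trans (req_wconj _ H) _; exact: wconjK.
move=> P P' H; apply/subsetP => x /suppP [b Hb]; apply: contraT => Nx.
pose a := fun l : V * bool => l.1 == x.
have C0 : count a u = 0.
  apply/eqP; rewrite -leqn0 leqNgt -has_count; apply/hasPn => l Hl.
  by apply: contra Nx => /eqP <-; exact: mem_supp.
have C1 : 0 < count a u' by rewrite -has_count; apply/hasP; exists (x, b); rewrite /a /=.
pose n := (2 * size c').+1.
have E : req (wexp u' n) (wconj c' (wexp u n)).
  exact: req_trans (req_wexp n H) (wexp_wconj _ _ _).
have /teq_perm/permP/(_ a) := norm_teq (P' n) E.
have := count_norm a (wconj c' (wexp u n)); have := count_wconj a c' (wexp u n).
rewrite !count_wexp C0 muln0 => H1 H2 H3.
have : n <= n * count a u' by rewrite leq_pmulr.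
by rewrite H3 => H4; have := leq_trans H4 (leq_trans H2 H1); rewrite addn0 ltnn.
Qed.

Lemma cyclic_reduction A a : over A a ->
  exists g w, [/\ req a (wconj g w), power_reduced w, over A g & over A w].
Proof.
move/over_norm => HA; have R := @reduced_norm a.
suff [g [w [H1 H2 H3 H4]]] : exists g w, [/\ req (norm a) (wconj g w), power_reduced w, over A g & over A w].
  by exists g, w; split=> //; apply: req_trans H1; exact/req_sym/norm_req.
move: (norm a) HA R => r; have [n] := ubnP (size r); elim: n r => // n IH r Hn HA R.
have [[l [r' Hr]]|N] := classic (exists l r', teq r (l :: r' ++ [:: linv l])).
  have Sr := teq_size Hr; rewrite /= size_cat addn1 in Sr.
  move: HA; rewrite (over_teq _ Hr) -cat1s !over_cat => /and3P[Hl Hr' _].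
  have Rr' : reduced r' by have := reduced_teq Hr R => /(@reduced_tail _) /reduced_catl.
  have [|g [w [H1 H2 H3 H4]]] := IH r' _ Hr' Rr'; first by move: Hn; rewrite Sr; lia.
  exists (g ++ [:: linv l]), w; split=> //.
    apply: req_trans (teq_req Hr) _; rewrite wconj_cat.
    have := req_wconj [:: linv l] H1; apply: req_trans.
    by rewrite {1}/wconj winv_cons linvK; exact: req_refl.
  by rewrite over_cat H3.
exists [::], r; split=> //; first by rewrite /wconj /= cats0; exact: req_refl.
elim=> [|m IHm]; first exact: reduced_nil.
(* A cancellation between [r] and the next copy lets [r] be written as a trace with [linv l] at the
   front and [l] at the end, which [N] excludes. *)
rewrite wexpS; case: (reduced_cat R IHm) => // -[l [u [v [Hu Hv]]]].
have Hlr : l \in r by rewrite (perm_mem (teq_perm Hu)) mem_cat mem_head orbT.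
case: m Hv {IHm} => [|m] /teq_rm [s] //.
rewrite wexpS rm_cat; case E: (rm (linv l) r) => [r1|]; last first.
  by case: ifP => // /allP /(_ _ Hlr); rewrite /= e_irr.
move=> _ _; case: N; exists (linv l).
have : teq ((linv l) :: r1) (u ++ [:: l]).
  by apply: teq_trans Hu; apply/teq_sym/rm_teq.
move/teq_winv; rewrite winv_cons winv_cat /= linvK => /teq_rm [t].
rewrite rm_cat; case E2: (rm (linv l) (winv r1)) => [t'|] /=; last first.
  by case: ifP => //; rewrite eq_sym linv_neq e_irr.
move=> _ _; exists (winv t'); apply: teq_trans (rm_teq E) _; apply/teq_cons.
have := teq_winv (rm_teq E2); rewrite winvK winv_cons linvK.
by [].
Qed.

(** * Pure factors and generic conjugates of vertices *)

(** Connectedness of [S] in the graph of non-commuting pairs, stated as an induction principle along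
    its edges. *)
Definition connected (S : {set V}) := forall (P : V -> Prop) x, x \in S -> P x ->
  (forall y z, y \in S -> z \in S -> ~~ e y z -> P y -> P z) ->
  forall z, z \in S -> P z.

Lemma connected1 x : connected [set x].
Proof. by move=> P y /set1P -> Px _ z /set1P ->. Qed.

Definition irreducible w := [/\ power_reduced w, connected (supp w) & w <> [::]].

Lemma irreducible1 x b : irreducible [:: (x, b)].
Proof. by split=> //; [exact: power_reduced1 | rewrite supp1; exact: connected1]. Qed.

Lemma irreducible_supp w : irreducible w -> exists x, x \in supp w.
Proof. by case=> _ _; case: w => // l w _; exists l.1; apply: mem_supp; exact: mem_head. Qed.

Lemma wexp_cat_com u w n : (forall l k, l \in u -> k \in w -> e l.1 k.1) ->
  teq (wexp (u ++ w) n) (wexp u n ++ wexp w n).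
Proof.
move=> H; elim: n => // n IH; rewrite !wexpS -!catA; apply: teq_cat => //.
apply: (@teq_trans (w ++ (wexp u n ++ wexp w n))); first exact: teq_cat.
rewrite !(catA _ _ (wexp w n)); apply: teq_cat => //.
have {IH} : forall k l, k \in w -> l \in wexp u n -> e k.1 l.1.
  move=> k l Hk Hl; rewrite e_sym; apply: H => //.
  by move: Hl => /flattenP [s]; rewrite mem_nseq => /andP[_ /eqP ->].
elim: w {H} => [|k w IH] H /=; first by rewrite cats0.
apply: (@teq_trans (k :: wexp u n ++ w)); first apply/teq_cons/IH.
  by move=> k' l' Hk'; apply: H; rewrite in_cons Hk' orbT.
by apply: teq_move; apply/allP => l' Hl'; apply: H => //; exact: mem_head.
Qed.

(** By [centralizer_split] the conjugate is a product of a part over [supp w] and a part over its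
    link. Their cyclic reductions together have support [supp w'], which is connected and so falls
    entirely on one side. *)
Lemma centralizer_irreducible c w w' : power_reduced w -> irreducible w' ->
  com (wconj c w') w ->
  (exists p, [/\ req (wconj c w') p, over (mem (supp w)) p & supp w' \subset supp w]) \/
  (exists p, [/\ req (wconj c w') p, over (link (supp w)) p & over (link (supp w)) w']).
Proof.
move=> P Hw' C; have [P' Hconn _] := Hw'; have [x Hx] := irreducible_supp Hw'.
have [p [q [Hpq Sp Lq]]] := centralizer_split P C.
have [r [p0 [Hp Pp Sr Sp0]]] := cyclic_reduction Sp.
have [s [q0 [Hq Pq Ls Lq0]]] := cyclic_reduction Lq.
set S := supp w in Sp Lq Sr Sp0 Ls Lq0 *.
have E : req (wconj c w') (wconj (r ++ s) (p0 ++ q0)).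
  apply: req_trans Hpq _; rewrite wconj_cat; apply: req_sym.
  apply: req_trans (req_wconj s (wconj_mul _ _ _)) _.
  apply: req_trans (wconj_mul _ _ _) _; apply: req_cat.
    apply: req_trans (req_sym Hp); apply: wconj_com; apply: com_sym.
    by apply: (com_link (S := S)) => //; rewrite /wconj !over_cat over_winv Sr Sp0.
  apply: req_trans (req_sym Hq); apply: req_wconj; apply: wconj_com.
  exact: com_link Sr Lq0.
have P0 : power_reduced (p0 ++ q0).
  move=> n; have /teq_sym T : teq (wexp (p0 ++ q0) n) (wexp p0 n ++ wexp q0 n).
    apply: wexp_cat_com => l k /(allP Sp0) Hl /(allP Lq0) Hk; exact: linkP Hk Hl.
  apply: reduced_teq T _; case: (reduced_cat (Pp n) (Pq n)) => // -[l [u1 [u2 [H1 H2]]]].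
  have := over_wexp n Sp0; rewrite (over_teq _ H1) over_cat => /andP[_ /andP[Hl _]].
  have := over_wexp n Lq0; rewrite (over_teq _ H2) => /andP[/= Hl' _].
  by case: (link_disj Hl Hl').
have ES : supp (p0 ++ q0) = supp w'.
  apply: (@power_reduced_conj_supp (c ++ winv (r ++ s))) => //.
  rewrite wconj_cat; apply: req_sym; apply: req_trans (req_wconj _ E) _; exact: wconjK.
have Hsl y : y \in supp w' -> (y \in S) || link S y.
  rewrite -ES => /suppP [b]; rewrite mem_cat => /orP[/(allP Sp0)|/(allP Lq0)] /= -> //.
  exact: orbT.
have dis y z : y \in S -> link S z -> e y z by move=> Hy Hz; exact: linkP Hz Hy.
case/orP: (Hsl x Hx) => Hx'; [left|right].
  have Sub y : y \in supp w' -> y \in S.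
    apply: (Hconn (fun y => is_true (y \in S)) x) => // y' z _ /Hsl /orP[//|Lz] N Hy.
    by rewrite (dis y' z) in N.
  have q0E : q0 = [::].
    apply: supp0; apply/eqP; rewrite -subset0; apply/subsetP => y Hy.
    have Hy' : y \in S.
      by apply: Sub; rewrite -ES; case/suppP: Hy => b Hb; apply/suppP; exists b; rewrite mem_cat Hb orbT.
    by case: (link_disj Hy'); move/overP: Lq0; apply.
  exists p; split=> //; last by apply/subsetP.
  apply: req_trans Hpq _; rewrite -[X in req _ X]cats0; apply: req_catl.
  by apply: req_trans Hq _; rewrite q0E /wconj /=; exact: req_mulVw.
have Sub y : y \in supp w' -> link S y.
  apply: (Hconn (fun y => is_true (link S y)) x) => // y' z _ /Hsl /orP[Sz|//] N Hy.
  by rewrite e_sym (dis z y') in N.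
have p0E : p0 = [::].
  apply: supp0; apply/eqP; rewrite -subset0; apply/subsetP => y Hy.
  have Hy' : y \in S by move/overP: Sp0; apply.
  case: (link_disj Hy'); apply: Sub; rewrite -ES.
  by case/suppP: Hy => b Hb; apply/suppP; exists b; rewrite mem_cat Hb.
exists q; split=> //; last by apply/overP.
apply: req_trans Hpq _; apply: (@req_catr _ [::]).
by apply: req_trans Hp _; rewrite p0E /wconj /=; exact: req_mulVw.
Qed.

Lemma over_link_irreducible w : irreducible w -> ~ over (link (supp w)) w.
Proof. by case/irreducible_supp => x Hx /overP /(_ x Hx); exact: link_disj. Qed.

(** [centralizer_irreducible] is applied both ways. If [supp w'] is contained in [supp w], the other
    direction must give containment too, since a support does not meet its link. *)
Lemma commuting_irreducibles g g' w w' : irreducible w -> irreducible w' ->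
  com (wconj g w) (wconj g' w') ->
  (supp w = supp w' /\
   exists2 p, req (wconj (winv g) (wconj g' w')) p & over (mem (supp w)) p) \/
  (exists p, [/\ req (wconj (winv g) (wconj g' w')) p, over (link (supp w)) p &
     over (link (supp w)) w']).
Proof.
move=> Hw Hw' C; have [P _ _] := Hw; have [P' _ _] := Hw'.
have C1 : com (wconj (g' ++ winv g) w') w.
  by rewrite wconj_cat; apply: com_sym; move/com_wconjr: C.
have C2 : com (wconj (g ++ winv g') w) w'.
  by rewrite wconj_cat; apply: com_sym; move/com_sym/com_wconjr: C.
rewrite -wconj_cat.
case: (centralizer_irreducible P Hw' C1) => [[p [H1 H2 H3]]|]; last by right.
left; split; last by exists p.
case: (centralizer_irreducible P' Hw C2) => [[q [_ _ H6]]|[q [_ _ H6]]].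
  by apply/eqP; rewrite eqEsubset H6 H3.
have [x Hx] := irreducible_supp Hw'.
by have /overP/(_ x (subsetP H3 x Hx)) /(link_disj Hx) := H6.
Qed.

(** Equality of supports puts the second factor, conjugated back by [g], into the subgroup on
    [supp w], where [centralizer_com] applies. *)
Lemma commuting_class g g' w w' a : irreducible w -> irreducible w' ->
  com (wconj g w) (wconj g' w') -> supp w = supp w' ->
  com (wconj g w) a -> com (wconj g' w') a.
Proof.
move=> Hw Hw' C ES Ca; have [P _ _] := Hw.
case: (commuting_irreducibles Hw Hw' C) => [[_ [p Hp Sp]]|[p [_ _]]]; last first.
  by rewrite ES => /(over_link_irreducible Hw').
have Cp : com p w.
  apply: (com_req Hp (req_refl w)); apply: com_sym; exact/com_wconjr.
have Ca' : com (wconj (winv g) a) w by apply/com_sym/com_wconjr.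
have := centralizer_com P Cp Ca' Sp => /(com_wconj g).
apply: com_req; last exact: wconjVK.
apply: req_trans (req_wconj g (req_sym Hp)) _; exact: wconjVK.
Qed.

(** Different supports leave only the link alternative, so the first vertex conjugate commutes with
    the second factor. [centralizer_irreducible], now for a single vertex, then puts it over the
    link of [supp w'], where it commutes with the second vertex conjugate. *)
Lemma commuting_conjugates g g' w w' (k k' : word V) x x' : irreducible w -> irreducible w' ->
  com (wconj g w) (wconj g' w') -> supp w <> supp w' ->
  over (mem (supp w)) k -> over (mem (supp w')) k' -> x \in supp w -> x' \in supp w' ->
  com (wconj (k ++ g) [:: (x, true)]) (wconj (k' ++ g') [:: (x', true)]).
Proof.
move=> Hw Hw' C NS Sk Sk' Hx Hx'; have [P' _ _] := Hw'.
case: (commuting_irreducibles Hw Hw' C) => [[]//|[p [Hp Lp Lw']]].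
have Sx u (S : {set V}) y : over (mem S) u -> y \in S -> over (mem S) (wconj u [:: (y, true)]).
  by move=> Hu Hy; rewrite /wconj !over_cat over_winv Hu /= /over /= Hy.
have C1 : com (wconj (k ++ g) [:: (x, true)]) (wconj g' w').
  rewrite wconj_cat; apply/com_wconjr; apply: com_req (req_refl _) (req_sym Hp) _.
  exact: com_link (Sx _ _ _ Sk Hx) Lp.
have C2 : com (wconj ((k ++ g) ++ winv g') [:: (x, true)]) w'.
  by rewrite (wconj_cat (k ++ g)); apply/com_sym/com_wconjr/com_sym.
case: (centralizer_irreducible P' (irreducible1 x true) C2) => [[q [_ _]]|[q [Hq Lq _]]].
  rewrite supp1 sub1set => Hx2; exfalso.
  by have /overP/(_ x Hx2) /(link_disj Hx) := Lw'.
apply: com_sym; rewrite (wconj_cat k'); apply/com_wconjr; rewrite -wconj_cat.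
apply: com_req (req_refl _) (req_sym Hq) _; exact: com_link (Sx _ _ _ Sk' Hx') Lq.
Qed.

Lemma com_gens (A : pred V) h u : (forall y, A y -> com h [:: (y, true)]) ->
  over A u -> com h u.
Proof.
move=> H; elim: u => [_|[y b] u IH /andP[/= Hy Hu]]; first exact: com_nil.
apply: (@com_cat _ [:: (y, b)]); last exact: IH.
by case: b; [exact: H | apply/(@com_winvE _ [:: (y, false)])/H].
Qed.

(* Conjugating by large powers of the successive vertices of a walk: a first vertex
   not commuting with [h] leaves a leading syllable that the later ones only cover. *)
Lemma conj_escape (H : seq (word V)) x p : path (fun y z => ~~ star y z) x p ->
  exists k : word V, over (mem (x :: p)) k /\
    forall h, h \in H -> (forall y, y \in x :: p -> com h [:: (y, true)]) \/
                         ev x (wconj (winv k) h) != 0%R.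
Proof.
have bnd y (s : seq (word V)) : exists n, forall h, h \in s -> `|ev y h| < n.
  exists (\max_(h <- s) `|ev y h|).+1 => h Hh; rewrite ltnS.
  exact: leq_bigmax_seq.
have over_n y n (A : pred V) : A y -> over A (nseq n (y, true)).
  by move=> Hy; rewrite /over all_nseq /= Hy orbT.
elim: p x => [|y p IH] x /=.
  move=> _; have [n Hn] := bnd x H; exists (nseq n (x, true)).
  split=> [|h Hh]; first by apply: over_n; rewrite /= mem_head.
  have [C|N] := classic (com h [:: (x, true)]); last by right; apply: ev_conj_nseq => //; exact: Hn.
  by left=> y; rewrite inE => /eqP->.
move=> /andP[Nxy /IH [k [Sk Hk]]].
have [n Hn] := bnd x [seq wconj (winv k) h | h <- H]; exists (nseq n (x, true) ++ k).
split=> [|h Hh].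
  rewrite over_cat over_n /= ?mem_head //=; apply: over_sub Sk => z /= Hz.
  by rewrite in_cons Hz orbT.
rewrite winv_cat wconj_cat.
have [N|C] := classic (~ com (wconj (winv k) h) [:: (x, true)]).
  by right; apply: ev_conj_nseq => //; apply: Hn; exact: map_f.
have {}C := NNPP _ C; case: (Hk h Hh) => [Call|]; last first.
  by move/(ev_nonstar Nxy)/(_ C).
left=> z; rewrite in_cons => /orP[/eqP->|]; last exact: Call.
apply: com_req C; last exact: req_refl.
by apply: wconj_com; apply/com_sym/com_winv/(com_gens _ Sk).
Qed.

Lemma connected_walk (S : {set V}) x : connected S -> x \in S ->
  exists p, [/\ path (fun y z => ~~ star y z) x p, {subset p <= S} & {subset S <= x :: p}].
Proof.
move=> HC Hx.
have W y z : y \in S -> z \in S ->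
    exists p, [/\ path (fun y z => ~~ star y z) y p, {subset p <= S} & last y p = z].
  move=> Hy; move: z; apply: (HC _ y Hy); first by exists [::].
  move=> z t _ Ht Nzt [p [Hp Sp Lp]]; have [->|Etz] := eqVneq t z; first by exists p.
  exists (rcons p t); split; last by rewrite last_rcons.
    by rewrite rcons_path Hp Lp /star negb_or Etz.
  by move=> s; rewrite mem_rcons in_cons => /orP[/eqP->|/Sp].
suff [p [H1 H2 H3]] : exists p, [/\ path (fun y z => ~~ star y z) x p, {subset p <= S}
    & {subset enum S <= x :: p}].
  by exists p; split=> // y Hy; apply: H3; rewrite mem_enum.
have : {subset enum S <= S} by move=> y; rewrite mem_enum.
elim: (enum S) => [|y s IH] Hs; first by exists [::].
have [|p [H1 H2 H3]] := IH; first by move=> z Hz; apply: Hs; rewrite in_cons Hz orbT.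
have Hl : last x p \in S by have := mem_last x p; rewrite in_cons => /orP[/eqP->|/H2].
have [q [Q1 Q2 Q3]] := W _ _ Hl (Hs y (mem_head _ _)).
exists (p ++ q); split.
- by rewrite cat_path H1.
- by move=> z; rewrite mem_cat => /orP[/H2|/Q2].
move=> z; rewrite in_cons => /orP[/eqP->|/H3].
  by rewrite -cat_cons mem_cat -Q3; have := mem_last (last x p) q;
     rewrite in_cons => /orP[/eqP->|->]; rewrite ?mem_last ?orbT.
by rewrite -cat_cons mem_cat => ->.
Qed.

(** [conj_escape] is used along a walk through [S] after [x], starting at a vertex [u] that does not
    commute with [x]. If the conjugated [h] has a non-zero exponent at [u], it does not commute with
    [x]. Otherwise [h] commutes with the walk, is fixed by the conjugation, and so commutes with [x]
    too. *)
Lemma generic_conjugate (S : {set V}) x (H : seq (word V)) : connected S -> x \in S ->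
  exists k : word V, over (mem S) k /\ forall h, h \in H -> com (wconj k [:: (x, true)]) h ->
    forall y, y \in S -> com h [:: (y, true)].
Proof.
move=> HC Hx; have [[|u p] [Hp Sp Cp]] := connected_walk HC Hx.
  exists [::]; split=> // h _; rewrite /wconj /= => C y /Cp; rewrite inE => /eqP->.
  exact: com_sym.
move: Hp => /= /andP[Nxu /(conj_escape H) [k [Sk Hk]]].
exists k; split=> [|h Hh C]; first by apply: over_sub Sk => y /= /Sp.
have {}C : com (wconj (winv k) h) [:: (x, true)] by apply: com_sym; apply/com_wconjr.
case: (Hk h Hh) => [Call|]; last by move/(ev_nonstar Nxu)/(_ C).
move=> y /Cp; rewrite in_cons => /orP[/eqP->|]; last exact: Call.
apply: com_req C; last exact: req_refl.
by apply: wconj_com; apply/com_sym/com_winv/(com_gens _ Sk).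
Qed.

(** Letters in the star of [x] are stripped from the left of [q], letters in the star of [y] from
    the right. The rest [r] makes [wconj r [:: (x, true)]] reduced; commuting with [y], this lies
    over the star of [y], so [r] is empty. *)
Lemma commuting_conjugate_factor q x y :
  com (wconj q [:: (x, true)]) [:: (y, true)] ->
  exists s s', [/\ req q (s ++ s'), over (star x) s, over (star y) s' & star x y].
Proof.
suff main n r : size r < n -> reduced r -> com (wconj r [:: (x, true)]) [:: (y, true)] ->
    exists s s', [/\ req r (s ++ s'), over (star x) s, over (star y) s' & star x y].
  move=> C; have [|s [s' [H1 H2 H3 H4]]] := main _ (norm q) (ltnSn _) (@reduced_norm q).
    by apply: com_req C; [exact/req_wconjl/req_sym/norm_req | exact: req_refl].
  by exists s, s'; split=> //; apply: req_trans H1; exact/req_sym/norm_req.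
elim: n r => // n IH r Hn R C.
have [[l [r' [Hl Hr]]]|NL] := classic (exists l r', star x l.1 /\ teq r (l :: r')).
  have Sr := teq_size Hr.
  have [| | |s [s' [H1 H2 H3 H4]]] := IH r'.
  - by move: Hn; rewrite Sr.
  - by have := reduced_teq Hr R; exact: reduced_tail.
  - apply: com_req C; last exact: req_refl.
    apply: req_trans (req_wconjl _ (teq_req Hr)) _; rewrite -cat1s wconj_cat.
    apply: req_wconj; apply: wconj_com; by apply: com_letter; rewrite /= e_sym.
  exists (l :: s), s'; split=> //; last by rewrite /= Hl.
  by apply: req_trans (teq_req Hr) _; exact: req_cons.
have [[l [r' [Hl Hr]]]|NT] := classic (exists l r', star y l.1 /\ teq r (r' ++ [:: l])).
  have Sr := teq_size Hr; rewrite size_cat addn1 in Sr.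
  have [| | |s [s' [H1 H2 H3 H4]]] := IH r'.
  - by move: Hn; rewrite Sr.
  - exact: reduced_catl (reduced_teq Hr R).
  - apply/(com_wconjE [:: l]); apply: com_req C.
      by rewrite -wconj_cat; apply/req_wconjl/teq_req.
    by apply/req_sym/wconj_com/com_letter; rewrite /= e_sym.
  exists s, (s' ++ [:: l]); split=> //; last by rewrite over_cat H3 /= Hl.
  by apply: req_trans (teq_req Hr) _; rewrite catA; exact: req_catr.
have R1 : reduced ((x, true) :: r).
  apply: reduced_cons => //; case E: (rm _ _) => [v|] //; case: NL.
  by exists (linv (x, true)), v; split; [rewrite /star eqxx | exact: rm_teq].
have R2 : reduced (wconj r [:: (x, true)]).
  case: (reduced_cat (reduced_winv R) R1) => // -[l [u [v [Hu]]]].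
  move/teq_rm => [s] /=; have Hr : teq r (linv l :: winv u).
    by have := teq_winv Hu; rewrite winvK winv_cat.
  case: eqP => [El _ _|_].
    by case: NL; exists (linv l), (winv u); split=> //; rewrite -El /star eqxx.
  case: ifP => // Hlx _ _; case: NL; exists (linv l), (winv u); split=> //.
  by rewrite /star /= e_sym Hlx orbT.
have := com_star_norm C; rewrite (norm_id R2) /wconj !over_cat => /and3P[_ Hx Hr].
have r0 : r = [::].
  case/lastP: r Hr NT {Hn IH R C NL R1 R2} => // r l; rewrite -cats1 over_cat => /andP[_ /andP[Hl _]].
  by case; exists l, r.
exists [::], [::]; rewrite r0; split=> //; first exact: req_refl.
by move: Hx; rewrite /= andbT /star eq_sym e_sym.
Qed.

(** * Components of supports, and exponent sums *)

Lemma teq_partition (rho : V -> V) w :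
  (forall x y, x \in supp w -> y \in supp w -> rho x != rho y -> e x y) ->
  teq w (flatten [seq wsub (fun x => rho x == r) w | r <- enum V]).
Proof.
move=> H; suff main (s : seq V) w' : uniq s -> (forall x, x \in supp w' -> rho x \in s) ->
    {subset supp w' <= supp w} ->
    teq w' (flatten [seq wsub (fun x => rho x == r) w' | r <- s]).
  by apply: main => // [|x _]; [exact: enum_uniq | rewrite mem_enum].
elim: s w' => [|r s IH] w' /=.
  by case: w' => // l w' _ /(_ l.1); rewrite (mem_supp (mem_head _ _)) => /(_ isT).
move=> /andP[Nv Us] Hs Sub; pose A x := rho x == r.
apply: (@teq_trans (wsub A w' ++ wsub (predC A) w')).
  apply: teq_split => x y Hx Hy /eqP Ex Ny; apply: H; try exact: Sub.
  by rewrite Ex eq_sym.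
apply: teq_cat => //.
have -> : [seq wsub (fun x => rho x == t) w' | t <- s] =
          [seq wsub (fun x => rho x == t) (wsub (predC A) w') | t <- s].
  apply/eq_in_map => t Hu; rewrite /wsub -filter_predI; apply: eq_filter => l /=.
  rewrite /A; case: eqP => //= ->; apply/esym.
  by apply: contra Nv => /eqP <-.
apply: IH => // [x|x]; rewrite supp_wsub => /andP[/= Ax Hx]; last exact: Sub.
by have := Hs x Hx; rewrite in_cons -/(A x) (negbTE Ax).
Qed.

Definition dep (S : {set V}) : rel V := fun x y => [&& x \in S, y \in S & ~~ e x y].

Definition croot S x := root (dep S) x.

Lemma dep_sym S : connect_sym (dep S).
Proof. by apply: sym_connect_sym => x y; rewrite /dep e_sym andbCA. Qed.

Lemma croot_mem (S : {set V}) x : x \in S -> croot S x \in S.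
Proof.
move=> Hx; rewrite /croot; have := connect_root (dep S) x; move: (root _ _) => y.
case/connectP => p; elim: p x Hx => [|z p IH] x Hx /=; first by move=> _ ->.
by move=> /andP[/and3P[_ Hz _] Hp]; exact: IH.
Qed.

Lemma croot_dep (S : {set V}) x y : x \in S -> y \in S -> croot S x != croot S y -> e x y.
Proof.
move=> Hx Hy; rewrite /croot root_connect; last exact: dep_sym.
by apply: contraR => Nxy; apply: connect1; rewrite /dep Hx Hy.
Qed.

Lemma connected_croot (S : {set V}) r : connected [set x in S | croot S x == r].
Proof.
move=> P x; rewrite inE => /andP[Hx /eqP Ex] Px Hstep z; rewrite inE => /andP[Hz].
rewrite -Ex /croot root_connect; last exact: dep_sym.
rewrite (dep_sym S) => /connectP [p]; elim: p x Hx Ex Px => [|y p IH] x Hx Ex Px /=.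
  by move=> _ ->.
move=> /andP[Hxy Hp] Ez; have /and3P[_ Hy Nxy] := Hxy.
have Ey : croot S y = r.
  rewrite -Ex; apply/esym/eqP; rewrite /croot root_connect; [exact: connect1 | exact: dep_sym].
apply: (IH y) => //; apply: Hstep Px => //; rewrite inE ?Hx ?Hy ?Ex ?Ey //=.
Qed.

(** [root] picks an element from the component as a set, so the choice does not depend on the
    ambient support. *)
Lemma croot_inj (S S' : {set V}) r r' : [set x in S | croot S x == r] = [set x in S' | croot S' x == r'] ->
  [set x in S | croot S x == r] != set0 -> r = r'.
Proof.
move=> E /set0Pn [x Hx].
have main (T : {set V}) t : x \in [set y in T | croot T y == t] ->
    t = odflt x [pick y in [set y in T | croot T y == t]].
  rewrite inE => /andP[HT /eqP Eu]; rewrite -{1}Eu /croot /root.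
  congr odflt; apply: eq_pick => y; rewrite inE -Eu.
  rewrite /croot (eq_sym (root _ y)) root_connect; last exact: dep_sym.
  apply/idP/andP => [H|[]//]; split=> //; case/connectP: H => p.
  elim: p x HT {Eu Hx} => [|z p IH] x' Hx' /=; first by move=> _ ->.
  by move=> /andP[/and3P[_ Hz _] Hp]; exact: IH.
by rewrite (main _ _ Hx) E -(main S' r') // -E.
Qed.

(** A conjugation-invariant homomorphism to the integers: it measures how far an element of the
    centralizer of [x] translates the line of [x], and it tells conjugates of different vertices
    apart. *)
Fixpoint esum x w : int :=
  if w is l :: w' then ((if l.1 == x then sgl l else 0) + esum x w')%R else 0%R.

Lemma esum_cat x u w : esum x (u ++ w) = (esum x u + esum x w)%R.
Proof. by elim: u => [|l u IH] /=; rewrite ?add0r // IH addrA. Qed.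

Lemma esum_winv x w : esum x (winv w) = (- esum x w)%R.
Proof.
elim: w => [|l w IH]; first by rewrite /= oppr0.
rewrite winv_cons esum_cat IH opprD addrC /= addr0; congr (_ + _)%R.
by case: ifP => _; rewrite ?oppr0 // /sgl /=; case: (l.2).
Qed.

Lemma esum_req x u w : req u w -> esum x u = esum x w.
Proof.
elim=> [u1 w1 H|//|u1 w1 _ -> //|u1 v1 w1 _ -> _ -> //].
case: H => [a b y c|a b y z by' bz _]; rewrite !esum_cat /=; congr (_ + _)%R.
  by rewrite /sgl /=; case: ifP; case: c => _ /=; lia.
by rewrite /=; lia.
Qed.

Lemma esum_wconj x g w : esum x (wconj g w) = esum x w.
Proof. by rewrite /wconj !esum_cat esum_winv; lia. Qed.

Lemma esum_nseq x y n b : x != y -> esum x (nseq n (y, b)) = 0%R.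
Proof. by move=> N; elim: n => //= n ->; rewrite eq_sym (negbTE N). Qed.

Lemma ev_star x a h : over (star x) a -> ev x (a ++ h) = (esum x a + ev x h)%R.
Proof.
elim: a => [|l a IH] /=; first by rewrite add0r.
rewrite {1}/star => /andP[Hl /IH E].
case: (l.1 =P x) Hl => [El _|_ /= Hl].
  by have := ev_self l (a ++ h); rewrite El E => ->; rewrite addrA.
by rewrite ev_link // E add0r.
Qed.

Lemma ev_com x a h : com a [:: (x, true)] -> ev x (a ++ h) = (esum x a + ev x h)%R.
Proof.
move/com_star_norm => H; rewrite -(ev_req _ (req_catr h (norm_req a))) ev_star //.
by rewrite (esum_req x (norm_req a)).
Qed.

End Words.

(** * Homomorphisms, ping-pong and inflations *)

Lemma hom_ext_cat (V W : finType) (f : V -> word W) u w :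
  hom_ext f (u ++ w) = hom_ext f u ++ hom_ext f w.
Proof. by rewrite /hom_ext map_cat flatten_cat. Qed.

Lemma hom_ext_winv (V W : finType) (f : V -> word W) w :
  hom_ext f (winv w) = winv (hom_ext f w).
Proof.
elim: w => // -[x b] w IH; rewrite winv_cons hom_ext_cat IH.
rewrite -cat1s hom_ext_cat winv_cat; congr (_ ++ _).
by rewrite /hom_ext /= !cats0; case: b => //=; rewrite winvK.
Qed.

Lemma hom_ext1 (V W : finType) (f : V -> word W) x : hom_ext f [:: (x, true)] = f x.
Proof. by rewrite /hom_ext /= cats0. Qed.

Lemma hom_ext_comp (U V W : finType) (f : U -> word V) (g : V -> word W) w :
  hom_ext g (hom_ext f w) = hom_ext (fun x => hom_ext g (f x)) w.
Proof.
elim: w => // -[x b] w IH; rewrite -cat1s !hom_ext_cat IH; congr (_ ++ _).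
by rewrite /hom_ext /= !cats0; case: b => //; rewrite -/(hom_ext _ _) hom_ext_winv.
Qed.

Lemma hom_ext_req (V W : finType) (e : rel W) (f g : V -> word W) w :
  (forall x, raag_eq e (f x) (g x)) -> raag_eq e (hom_ext f w) (hom_ext g w).
Proof.
move=> H; elim: w => [|[x b] w IH]; first exact: req_refl.
apply: req_cat => //=; case: b => //; exact: req_winv.
Qed.

Lemma is_hom_com (V W : finType) (eV : rel V) (eW : rel W) (f : V -> word W) :
  (forall x y, eV x y -> com eW (f x) (f y)) -> is_hom eV eW f.
Proof.
move=> H w1 w2; elim=> [u w Huw|u|u w _ IH|u v w _ IH1 _ IH2].
- case: Huw => [a b x c|a b x y bx bY /H C]; rewrite !hom_ext_cat; apply: req_catl.
    apply: (@req_catr _ _ _ [::]); rewrite /hom_ext /= cats0.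
    by case: c => /=; [exact: req_mulwV | exact: req_mulVw].
  apply: req_catr; rewrite /hom_ext /= !cats0.
  have {}C : com eW (f y) (if bx then f x else winv (f x)).
    by case: bx; [|apply: com_winv]; exact: com_sym.
  suff : com eW (if bx then f x else winv (f x)) (if bY then f y else winv (f y)) by [].
  by case: bY; [|apply: com_winv]; exact: com_sym.
- exact: req_refl.
- exact: req_sym.
- exact: req_trans IH1 IH2.
Qed.

Lemma hom_com (V W : finType) (eV : rel V) (eW : rel W) (f : V -> word W) u w :
  is_hom eV eW f -> com eV u w -> com eW (hom_ext f u) (hom_ext f w).
Proof. by move=> Hf /Hf; rewrite !hom_ext_cat. Qed.

Lemma is_embedding_ker (V W : finType) (eV : rel V) (eW : rel W) (f : V -> word W) :
  is_hom eV eW f ->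
  (forall w, raag_eq eW (hom_ext f w) [::] -> raag_eq eV w [::]) ->
  is_embedding eV eW f.
Proof.
move=> Hf K; split=> // w1 w2 /req_divE; rewrite -hom_ext_winv -hom_ext_cat => /K ?.
exact/req_divE.
Qed.

(* The exponent of the leading syllable of [w] at [j], multiplied by [N], is read off
   up to a constant from the projection of the image of [w] to the line of the
   [j]-th conjugate. *)
Lemma pingpong (V J : finType) (e : rel V) (c : rel J) (lab : J -> V) (g : J -> word V) :
  symmetric e -> irreflexive e -> symmetric c -> irreflexive c -> injective lab ->
  (forall j k, j != k ->
     c j k <-> com e (wconj (g j) [:: (lab j, true)]) (wconj (g k) [:: (lab k, true)])) ->
  exists N, is_embedding c e (fun j => wconj (g j) (nseq N (lab j, true))).
Proof.
move=> es ei cs ci lab_inj Hc; pose M := \max_j size (g j).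
have HM j : size (g j) <= M by apply: (leq_bigmax j).
pose E j h := ev e (lab j) (g j ++ h).
(* [C] bounds the lengths of all [g j ++ winv (g k)], and with [N > 2 * C] a non-zero multiple of
   [N] stays above [C] in absolute value after an error of at most [C]. *)
pose C := 2 * M; pose N := (2 * C).+1; exists N.
set f := fun j => _.
have fcom j k : c j k -> com e (f j) (f k).
  have [->|Njk] := eqVneq j k; first by rewrite ci.
  move/(Hc _ _ Njk) => H.
  have P i : raag_eq e (wexp (wconj (g i) [:: (lab i, true)]) N) (f i).
    by have := wexp_wconj e (g i) [:: (lab i, true)] N; rewrite wexp1.
  apply: com_req (P j) (P k) _; apply: com_wexp; apply: com_sym; apply: com_wexp.
  exact: com_sym.
have fhom : is_hom c e f by apply: is_hom_com.
have Ereq j h h' : raag_eq e h h' -> E j h = E j h' by move=> H; apply/ev_req/req_catl.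
have Eself j h : E j (f j ++ h) = (N%:Z + E j h)%R.
  rewrite /E -ev_nseq //; apply: ev_req => //; rewrite /f /wconj -!catA; exact: req_canlV.
have EselfV j h : E j (winv (f j) ++ h) = (- N%:Z + E j h)%R.
  have := Eself j (winv (f j) ++ h); rewrite (Ereq _ _ _ (req_canlV e (f j) h)) => ->.
  lia.
have Ecom j k h : c j k -> E k (f j ++ h) = E k h.
  move=> Hjk; have Njk : j != k by apply: contraTneq Hjk => ->; rewrite ci.
  rewrite /E; set a := wconj (winv (g k)) (f j).
  have -> : ev e (lab k) (g k ++ f j ++ h) = ev e (lab k) (a ++ (g k ++ h)).
    apply: ev_req => //; rewrite /a; move: (f j) => F; rewrite /wconj winvK -!catA; do 2!apply: req_catl.
    exact/req_sym/req_canl.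
  rewrite ev_com //.
    rewrite /a /f !esum_wconj esum_nseq ?add0r // eq_sym.
    by apply: contra Njk => /eqP/lab_inj ->.
  apply: com_sym; apply/com_wconjr; apply: com_sym.
  have := wexp_wconj e (g j) [:: (lab j, true)] N; rewrite wexp1 => P.
  apply: com_req P (req_refl e _) _; apply: com_sym; apply: com_wexp; apply: com_sym.
  exact/Hc.
have EcomV j k h : c j k -> E k (winv (f j) ++ h) = E k h.
  move=> Hjk; rewrite -(Ecom j k _ Hjk); apply: Ereq; exact: req_canlV.
have beh j k h : j != k -> ~~ c j k -> C < `|E k h| -> `|E j h| <= C.
  move=> Njk /negP Nc Hk.
  have SC : size (g j ++ winv (g k)) <= C.
    by rewrite size_cat size_winv /C mul2n -addnn leq_add.
  apply: (leq_trans _ SC); have -> : E j h = ev e (lab j) ((g j ++ winv (g k)) ++ (g k ++ h)).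
    by apply: ev_req => //; rewrite -!catA; apply/req_catl/req_sym/req_canl.
  apply: (@behrstock _ e es ei _ (lab k)); last exact: leq_ltn_trans SC Hk.
  rewrite wconj_cat => H; apply: Nc; apply/Hc => //; apply: com_sym; apply/com_wconjr.
  exact: com_sym.
have E0 j : `|E j [::]| <= C.
  rewrite /E cats0; apply: leq_trans (ev_size _ _ _) _; apply: leq_trans (HM j) _.
  by rewrite /C mul2n -addnn leq_addl.
have main w : reduced c w -> forall j, absz (E j (hom_ext f w) - N%:Z * ev c j w)%R <= C.
  elim: w => [|[i b] w IH] R j; first by rewrite mulr0 subr0; exact: E0.
  have {}IH := IH (reduced_tail R).
  set l := (i, b) in R *; pose h := hom_ext f w.
  have self : absz (E i (hom_ext f (l :: w)) - N%:Z * ev c i (l :: w))%R <= C.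
    have := ev_self cs ci l w; rewrite [l.1]/= => ->.
    have -> : hom_ext f (l :: w) = (if b then f i else winv (f i)) ++ h by [].
    have := IH i; rewrite -/h /sgl /=; case: (b); rewrite ?Eself ?EselfV mulrDr ?mulr1 ?mulrN1.
      by move: (N%:Z * _)%R; lia.
    by move: (N%:Z * _)%R; lia.
  have [->|Nji] := eqVneq j i; first exact: self.
  have [Hij|Nij] := boolP (c i j).
    have Hji : c j (l.1) by rewrite cs.
    rewrite ev_link //; have -> : hom_ext f (l :: w) = (if b then f i else winv (f i)) ++ h by [].
    by have := IH j; case: (b); rewrite ?Ecom ?EcomV.
  (* The letter [i] leads, so [ev c j] vanishes while the coordinate at [i] exceeds [C]; [beh] then
     bounds the coordinate at [j]. *)
  have Lz : ev c i (l :: w) != 0%R by exact: (ev_lead cs ci R).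
  have NS : ~~ star c i j by rewrite /star negb_or Nji.
  rewrite (ev_excl cs NS Lz) mulr0 subr0.
  apply: (beh j i) => //; first by rewrite cs.
  move: self Lz; set X := E i _; set Y := ev c i _ => S1 S2.
  have : N <= absz (N%:Z * Y)%R by rewrite abszM absz_nat leq_pmulr // absz_gt0.
  by move: S1; move: (N%:Z * Y)%R; rewrite /N => Z; lia.
apply: is_embedding_ker => // w Hw.
have {}Hw : raag_eq e (hom_ext f (norm c w)) [::].
  by apply: req_trans Hw; apply/fhom/norm_req.
apply: req_trans (req_sym (norm_req cs w)) _; apply: NNPP => N1.
have [j Hj] := ev_ex cs ci N1.
have := main _ (@reduced_norm _ _ cs ci w) j; rewrite (Ereq _ _ _ Hw) => H1.
have := E0 j; move: Hj; set Y := ev _ _ _ => Hj H2.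
have : N <= absz (N%:Z * Y)%R by rewrite abszM absz_nat leq_pmulr // absz_gt0.
by move: H1 H2; move: (N%:Z * Y)%R; rewrite /N => Z; lia.
Qed.

(** Unless the sum of the higher terms vanishes, the lowest digit is a non-zero multiple of [N],
    contrary to its bound. *)
Lemma digits_eq0 (N n : nat) (a : 'I_n -> int) : (forall i, `|a i| < N) ->
  (\sum_(i < n) (N ^ i)%N%:Z * a i = 0)%R -> forall i, a i = 0%R.
Proof.
elim: n a => [|n IH] a Ha; first by move=> _ [].
rewrite big_ord_recl /= expn0 mul1r.
have -> : (\sum_(i < n) (N ^ bump 0 i)%N%:Z * a (lift ord0 i) =
           N%:Z * \sum_(i < n) (N ^ i)%N%:Z * a (lift ord0 i))%R.
  by rewrite mulr_sumr; apply: eq_bigr => i _; rewrite expnS PoszM mulrA.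
set X := (\sum_(i < n) _)%R => E.
have X0 : X = 0%R.
  apply/eqP; apply: contraT => NX; have := Ha ord0.
  have -> : a ord0 = (- (N%:Z * X))%R by move: E; lia.
  by rewrite abszN abszM absz_nat ltnNge leq_pmulr // absz_gt0.
have a0 : a ord0 = 0%R by move: E; rewrite X0 mulr0 addr0.
move=> i; have [j ->|->] := unliftP ord0 i; last exact: a0.
exact: (IH (fun j => a (lift ord0 j))).
Qed.

Definition infl_spec (V : finType) (n N : nat) (a : V * 'I_n) : word V :=
  nseq (N ^ a.2) (a.1, true).

Lemma infl_simple (V : finType) (e : rel V) n : symmetric e -> irreflexive e ->
  symmetric (infl_rel e n) /\ irreflexive (infl_rel e n).
Proof.
move=> es ei; split=> [[x i] [y j]|[x i]]; rewrite /infl_rel /=; last by rewrite !eqxx.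
by rewrite eq_sym (eq_sym i) es.
Qed.

Lemma infl_spec_hom (V : finType) (e : rel V) n N :
  is_hom (infl_rel e n) e (@infl_spec V n N).
Proof.
apply: is_hom_com => -[x i] [y j]; rewrite /infl_rel /= => H.
apply: com_words => l k; rewrite !mem_nseq => /andP[_ /eqP->] /andP[_ /eqP->] /=.
by case: eqP H.
Qed.

(** For a reduced word, the leading exponents at the copies of [x] act as base-[N] digits of the
    leading exponent of the image at [x]. Being bounded by the length, they cannot sum to 0 unless
    all vanish. *)
Lemma infl_spec_discr (V : finType) (e : rel V) n w N : symmetric e -> irreflexive e ->
  ~ raag_eq (infl_rel e n) w [::] -> size w < N ->
  ~ raag_eq e (hom_ext (@infl_spec V n N) w) [::].
Proof.
move=> es ei; have [s i] := @infl_simple V e n es ei; set e' := infl_rel e n in s i *.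
set f := @infl_spec V n N.
have ev_pow x m b h : ev e x ((if b then nseq m (x, true) else winv (nseq m (x, true))) ++ h)
    = (sgl (x, b) * m%:Z + ev e x h)%R.
  case: b; rewrite /sgl /= ?mul1r ?mulN1r; first exact: ev_nseq.
  have := ev_nseq es ei x m (winv (nseq m (x, true)) ++ h).
  rewrite (ev_req es ei x (req_canlV e _ _)) => ->; lia.
have main u : reduced e' u -> size u < N -> forall x,
    ev e x (hom_ext f u) = (\sum_(k < n) (N ^ k)%N%:Z * ev e' (x, k) u)%R.
  elim: u => [|[[y k] b] u IH] R Hu x.
    by rewrite big1 // => j _; rewrite mulr0.
  have {}IH := IH (reduced_tail R) (ltnW Hu).
  set l := (y, k, b) in R *; pose h := hom_ext f u.
  have Ef : hom_ext f (l :: u) =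
      (if b then nseq (N ^ k) (y, true) else winv (nseq (N ^ k) (y, true))) ++ h by [].
  have self : ev e y (hom_ext f (l :: u)) = (\sum_(k < n) (N ^ k)%N%:Z * ev e' (y, k) (l :: u))%R.
    rewrite Ef ev_pow IH (bigD1 k) //= [in RHS](bigD1 k) //=.
    have := ev_self s i l u; rewrite [l.1]/= => ->.
    rewrite mulrDr addrA (mulrC (sgl _)); congr (_ + _)%R.
    apply: eq_bigr => j Nj; rewrite ev_link //=.
    by rewrite /e' /infl_rel /= eqxx.
  have [->|Nxy] := eqVneq x y; first exact: self.
  have [Hxy|Nexy] := boolP (e x y).
    have -> : ev e x (hom_ext f (l :: u)) = ev e x h.
      rewrite Ef; have Hall (m : nat) h' (b' : bool) : ev e x (nseq m (y, b') ++ h') = ev e x h'.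
        by elim: m => //= m IHm; rewrite ev_link.
      case: (b); first exact: Hall.
      have -> : winv (nseq (N ^ k) (y, true)) = nseq (N ^ k) (y, false).
        by rewrite winvE map_nseq rev_nseq.
      exact: Hall.
    rewrite IH; apply: eq_bigr => j _; rewrite ev_link //.
    by rewrite /e' /infl_rel /= (negbTE Nxy).
  (* For [x] and [y] not commuting both sides vanish: in the inflation the leading [(y, k)] excludes
     every [(x, j)], and in the image [self] gives [y] a non-zero exponent, which excludes [x]. *)
  have Lz : ev e' (y, k) (l :: u) != 0%R by exact: (ev_lead s i R).
  rewrite big1 => [|j _]; last first.
    rewrite (ev_excl s _ Lz) ?mulr0 // /star /e' /infl_rel xpair_eqE /=.
    by rewrite (negbTE Nxy) (eq_sym y) (negbTE Nxy) es.
  apply: (@ev_excl _ e es y); first by rewrite /star negb_or Nxy es.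
  rewrite self; apply: contra Lz => /eqP /digits_eq0 H; apply/eqP; apply: H => j.
  by apply: leq_ltn_trans Hu; exact: ev_size.
move=> Nw Hw H; have [[x k] /negP Hx] := ev_ex s i Nw; apply: Hx; apply/eqP.
have Ew := norm_req s w; rewrite -(ev_req s i _ Ew).
have Sw := leq_ltn_trans (size_norm e' w) Hw.
have := main _ (@reduced_norm _ _ s i w) Sw x.
have E0 : raag_eq e (hom_ext f (norm e' w)) [::].
  by apply: req_trans H; apply: infl_spec_hom.
rewrite (ev_req es ei x E0) => /esym /digits_eq0 -> // j.
by apply: leq_ltn_trans Sw; exact: ev_size.
Qed.

(** * Universal sentences *)

Lemma hom_ext_eval (V W : finType) (f : V -> word W) s t :
  hom_ext f (eval_term s t) = eval_term (fun i => hom_ext f (s i)) t.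
Proof. by elim: t => //= [a IHa b IHb|a IHa]; rewrite ?hom_ext_cat ?hom_ext_winv ?IHa ?IHb. Qed.

Lemma infl_holds (V : finType) (e : rel V) n s f : symmetric e -> irreflexive e ->
  exists N0, forall N, N0 < N ->
    holds (infl_rel e n) s f <-> holds e (fun i => hom_ext (@infl_spec V n N) (s i)) f.
Proof.
move=> es ei; elim: f => [a b|f [N0 IH]|f [N1 IH1] g [N2 IH2]|f [N1 IH1] g [N2 IH2]] /=.
- exists (size (eval_term s a ++ winv (eval_term s b))) => N HN.
  rewrite -!hom_ext_eval; split; first exact: infl_spec_hom.
  move=> /req_divE; rewrite -hom_ext_winv -hom_ext_cat => H.
  by apply/req_divE; apply: NNPP => /infl_spec_discr /(_ HN); apply.
- by exists N0 => N /IH ->.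
- exists (maxn N1 N2) => N; rewrite gtn_max => /andP[/IH1 -> /IH2 ->].
  by [].
- exists (maxn N1 N2) => N; rewrite gtn_max => /andP[/IH1 -> /IH2 ->].
  by [].
Qed.

Lemma embedding_holds (V W : finType) (eV : rel V) (eW : rel W) (phi : V -> word W) s f :
  is_embedding eV eW phi ->
  holds eV s f <-> holds eW (fun i => hom_ext phi (s i)) f.
Proof.
move=> [H1 H2]; elim: f => [a b|f IH|f IH1 g IH2|f IH1 g IH2] /=; last 3 first.
- by rewrite IH.
- by rewrite IH1 IH2.
- by rewrite IH1 IH2.
by rewrite -!hom_ext_eval; split; [exact: H1 | exact: H2].
Qed.

(** An assignment is carried by [phi] into the inflation and by a specialization with large [N] into
    the group of [eW]; both keep the truth value of [f]. *)
Lemma embedding_univ (V W : finType) (eV : rel V) (eW : rel W) n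
    (phi : V -> word (W * 'I_n)%type) f :
  symmetric eW -> irreflexive eW -> is_embedding eV (infl_rel eW n) phi ->
  models_univ eW f -> models_univ eV f.
Proof.
move=> es ei Hphi Hf s; apply/(embedding_holds _ _ Hphi).
have [N0 H] := infl_holds (fun i => hom_ext phi (s i)) f es ei.
by apply/(H N0.+1 (ltnSn _)); exact: Hf.
Qed.

Definition wterm (V : finType) (w : word V) : gterm :=
  foldr (fun p t => TMul (let x := TVar (enum_rank p.1) in if p.2 then x else TInv x) t) TOne w.

Lemma eval_wterm (V W : finType) (s : nat -> word W) (w : word V) :
  eval_term s (wterm w) = hom_ext (fun x => s (enum_rank x)) w.
Proof. by elim: w => // -[x b] w IH; rewrite /= IH; case: b. Qed.

Definition bigand (fs : seq qf_formula) := foldr FAnd (FEq TOne TOne) fs.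

Lemma holds_bigand (V : finType) (e : rel V) s (T : eqType) (F : T -> qf_formula) ts :
  holds e s (bigand (map F ts)) <-> forall t, t \in ts -> holds e s (F t).
Proof.
elim: ts => [|t ts IH] /=; first by split=> // _; exact: req_refl.
rewrite IH; split=> [[H1 H2] t'|H].
  by rewrite in_cons => /orP[/eqP->|/H2].
by split=> [|t' Ht']; apply: H; rewrite in_cons ?eqxx // Ht' orbT.
Qed.

(** Otherwise the group of [eW] satisfies the universal sentence that no tuple obeys the relations
    of [eV] and keeps all of [ws] non-trivial; the generators refute it in the group of [eV]. *)
Lemma univ_discriminates (V W : finType) (eV : rel V) (eW : rel W) (ws : seq (word V)) :
  (forall f, models_univ eW f -> models_univ eV f) ->
  (forall w, w \in ws -> ~ raag_eq eV w [::]) ->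
  exists phi : V -> word W, (forall x y, eV x y -> com eW (phi x) (phi y)) /\
    forall w, w \in ws -> ~ raag_eq eW (hom_ext phi w) [::].
Proof.
move=> HU Hws.
pose comm (p : V * V) := let x := TVar (enum_rank p.1) in let y := TVar (enum_rank p.2) in
  FEq (TMul x y) (TMul y x).
pose pairs := [seq p <- enum {: V * V} | eV p.1 p.2].
pose f := FNot (FAnd (bigand (map comm pairs))
                     (bigand [seq FNot (FEq (wterm w) TOne) | w <- ws])).
apply: NNPP => N; have /HU : models_univ eW f.
  move=> s [/holds_bigand H1 /holds_bigand H2]; apply: N; exists (fun x => s (enum_rank x)).
  split=> [x y Hxy|w Hw]; first by apply: (H1 (x, y)); rewrite mem_filter Hxy mem_enum.
  by have := H2 w Hw; rewrite /= eval_wterm.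
(* The assignment of the generators themselves; variables beyond the vertices get the trivial
   word. *)
pose s i := nth [::] [seq [:: (x, true)] | x <- enum V] i.
have sE x : s (enum_rank x) = [:: (x, true)].
  by rewrite /s (nth_map x) ?nth_enum_rank // -cardE ltn_ord.
move=> /(_ s); apply; split; apply/holds_bigand.
  move=> [x y]; rewrite mem_filter => /andP[/= Hxy _]; rewrite /comm /= !sE.
  exact: (@req_swap _ _ (x, true) (y, true)).
move=> w /Hws Hw /=; rewrite eval_wterm => H; apply: Hw.
suff <- : hom_ext (fun x => s (enum_rank x)) w = w by [].
elim: w {H} => // -[x b] w IH; rewrite -cat1s hom_ext_cat IH; congr (_ ++ _).
by rewrite /hom_ext /= cats0 sE; case: b.
Qed.

(** * Patterns of commuting vertex conjugates *)

Section Pattern.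
Variables (I V : finType) (e : rel V).
Hypotheses (e_sym : symmetric e) (e_irr : irreflexive e).
Variable a : I -> word V.

Notation J := (I * V)%type.

Lemma wconj_flatten g (ws : seq (word V)) :
  raag_eq e (wconj g (flatten ws)) (flatten (map (wconj g) ws)).
Proof.
elim: ws => [|w ws IH] /=; first exact: req_mulVw.
exact: req_trans (wconj_mul e g w _) (req_catl _ IH).
Qed.

Lemma com_wconj_wsub (A : pred V) g w b : power_reduced e w ->
  (forall x y, x \in supp w -> y \in supp w -> A x -> ~~ A y -> e x y) ->
  com e (wconj g w) b -> com e (wconj g (wsub A w)) b.
Proof.
move=> P HA /com_wconjr C; apply/com_wconjr; apply: com_sym.
by apply: com_wsub => //; exact: com_sym.
Qed.

(* [b (i, r)] are the pure factors of [a i], indexed by the roots [r] of the components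
   of its cyclically reduced support ([L] tells which vertices are such roots).
   Commuting factors with equal support generate a cyclic group, so they must share
   one conjugate [t]: hence the passage to class representatives [rep]. *)
Lemma pure_factor_pattern : exists (L : pred J) (b k : J -> word V),
  let t j := wconj (k j) [:: (j.2, true)] in
  [/\ forall i, raag_eq e (a i) (flatten [seq b (i, r) | r <- enum V]),
      forall j, ~~ L j -> raag_eq e (b j) [::],
      forall j j', com e (t j) (t j') -> com e (b j) (b j')
    & forall j j', L j -> L j' -> com e (a j.1) (a j'.1) -> com e (t j) (t j')].
Proof.
have CR i : exists gw : word V * word V, raag_eq e (a i) (wconj gw.1 gw.2) /\ power_reduced e gw.2.
  have [|g [w [H1 H2 _ _]]] := cyclic_reduction e_sym e_irr (A := predT) (a := a i).
    exact: all_predT.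
  by exists (g, w).
have [gw Hgw] := fin_all_exists CR.
pose g i := (gw i).1; pose w i := (gw i).2; pose S i := supp (w i).
have Hg i : raag_eq e (a i) (wconj (g i) (w i)) by case: (Hgw i).
have Pw i : power_reduced e (w i) by case: (Hgw i).
pose wc (j : J) := wsub (fun y => croot e (S j.1) y == j.2) (w j.1).
pose b (j : J) := wconj (g j.1) (wc j).
pose L (j : J) := wc j != [::].
have sep i r x y : x \in supp (w i) -> y \in supp (w i) ->
    croot e (S i) x == r -> croot e (S i) y != r -> e x y.
  by move=> Hx Hy /eqP <- N; apply: (croot_dep e_sym Hx Hy); rewrite eq_sym.
have suppE j : supp (wc j) = [set x in S j.1 | croot e (S j.1) x == j.2].
  by apply/setP => x; rewrite supp_wsub inE andbC.
have irr j : L j -> irreducible e (wc j).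
  move=> /eqP Lj; split=> //.
    by apply: power_reduced_wsub => // x y; exact: sep.
  by rewrite suppE; exact: connected_croot.
have memr j : L j -> j.2 \in supp (wc j).
  move/irr/irreducible_supp => [x]; rewrite suppE => /setIdP [Hx /eqP <-].
  apply/setIdP; split; first exact: croot_mem.
  by rewrite /croot root_root //; exact: dep_sym.
have aE i : raag_eq e (a i) (flatten [seq b (i, r) | r <- enum V]).
  apply: req_trans (Hg i) _.
  have /(teq_req e_sym e_irr) H : teq e (w i) (flatten [seq wc (i, r) | r <- enum V]).
    apply: (@teq_partition _ e e_sym e_irr (croot e (S i))) => x y Hx Hy.
    exact: croot_dep.
  apply: req_trans (req_wconj (g i) H) _; apply: req_trans (wconj_flatten _ _) _.
  rewrite -map_comp; exact: req_refl.
have comb j j' : com e (a j.1) (a j'.1) -> com e (b j) (b j').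
  move=> C; have {}C := com_req (Hg _) (Hg _) C.
  apply: com_wconj_wsub => // [x y|]; first exact: sep.
  apply: com_sym; apply: com_wconj_wsub => // [x y|]; first exact: sep.
  exact: com_sym.
pose cls j j' := [&& L j, L j', supp (wc j) == supp (wc j') & reqb e (b j ++ b j') (b j' ++ b j)].
have clsP j j' : cls j j' -> [/\ L j, L j', supp (wc j) = supp (wc j') & com e (b j) (b j')].
  by case/and4P => -> -> /eqP -> /(reqP e_sym e_irr).
have clsI j j' : L j -> L j' -> supp (wc j) = supp (wc j') -> com e (b j) (b j') -> cls j j'.
  by move=> H1 H2 H3 H4; apply/and4P; split=> //; [exact/eqP | exact/(reqP e_sym e_irr)].
have clsC j j' c : cls j j' -> com e (b j) c -> com e (b j') c.
  case/clsP => Lj Lj' ES C; exact: (commuting_class e_sym e_irr (irr _ Lj) (irr _ Lj') C ES).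
have cls_sym j j' : cls j j' -> cls j' j.
  by case/clsP => Lj Lj' ES C; apply: clsI => //; exact: com_sym.
have cls_trans j j' j'' : cls j j' -> cls j' j'' -> cls j j''.
  move=> H1 H2; have [Lj Lj' E1 C1] := clsP _ _ H1; have [_ L2 E2 C2] := clsP _ _ H2.
  apply: clsI => //; first by rewrite E1.
  exact: clsC (cls_sym _ _ H1) C2.
have cls_refl j : L j -> cls j j by move=> Lj; apply: clsI => //; exact: com_refl.
(* [pick] depends only on the predicate, so [rep] is constant on classes; the default [j] is taken
   only outside [L]. *)
pose rep j := odflt j [pick j' | cls j j'].
have repP j : L j -> cls j (rep j).
  move=> Lj; rewrite /rep; case: pickP => [j' //|/(_ j)]; by rewrite cls_refl.
have rep_eq j j' : cls j j' -> rep j = rep j'.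
  move=> H; rewrite /rep; have -> : [pick j'' | cls j j''] = [pick j'' | cls j' j''].
    apply: eq_pick => i; apply/idP/idP; last exact: cls_trans.
    by apply: cls_trans; exact: cls_sym.
  by case: pickP => // /(_ j); rewrite cls_sym.
(* Passing to [rep j] may change the index in [I] but not the vertex, since equal components have
   equal roots. *)
have rep2 j : L j -> (rep j).2 = j.2.
  move=> Lj; have [_ _ E _] := clsP _ _ (repP j Lj); apply/esym.
  move: E; rewrite !suppE => E; apply: (croot_inj e_sym E); rewrite -suppE.
  by apply/set0Pn; exists j.2; exact: memr.
pose T (K : J -> word V) j := wconj (K j ++ g j.1) [:: (j.2, true)].
have [K [SK HK]] : exists K : J -> word V,
    (forall j, L j -> over (mem (supp (wc j))) (K j)) /\
    (forall j j', L j -> L j' -> com e (T K j) (T K j') -> com e (b j) (b j')).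
  suff [K [H1 _ H3]] : exists K : J -> word V,
      [/\ forall j, L j -> over (mem (supp (wc j))) (K j),
          forall j j', j \in enum {: J} -> L j -> L j' -> com e (T K j) (b j') -> com e (b j) (b j')
        & forall j j', j \in enum {: J} -> j' \in enum {: J} -> L j -> L j' ->
            com e (T K j) (T K j') -> com e (b j) (b j')].
    by exists K; split=> // j j'; apply: H3; rewrite mem_enum.
  have : uniq (enum {: J}) by exact: enum_uniq.
  (* The conjugators are chosen one index at a time, each generic with respect to all factors [b]
     and to the conjugates already chosen. *)
  elim: (enum {: J}) => [_|j0 s IH /= /andP[Nj0 /IH [K [H1 H2 H3]]]].
    by exists (fun=> [::]).
  have [Lj0|NL0] := boolP (L j0); last first.
    have Hs j : j \in j0 :: s -> L j -> j \in s.
      by rewrite in_cons => /orP[/eqP->|//]; rewrite (negbTE NL0).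
    exists K; split=> // j j' Hj; first by move=> Lj; apply: H2 => //; exact: Hs.
    by move=> Hj' Lj Lj'; apply: H3 => //; exact: Hs.
  pose H := [seq wconj (winv (g j0.1)) h | h <- [seq b j | j <- enum {: J}] ++ [seq T K j | j <- s]].
  have [P0 C0 _] := irr _ Lj0.
  have [k [Sk Hk]] := generic_conjugate e_sym e_irr H C0 (memr _ Lj0).
  have gen h : h \in [seq b j | j <- enum {: J}] ++ [seq T K j | j <- s] ->
      com e (wconj (k ++ g j0.1) [:: (j0.2, true)]) h -> com e (b j0) h.
    move=> Hh; rewrite wconj_cat => /com_wconjr /Hk Ch; apply/com_wconjr.
    by apply: com_sym; apply: com_gens (over_supp _) => y; apply: Ch; exact: map_f.
  pose K' j := if j == j0 then k else K j.
  have T0 : T K' j0 = wconj (k ++ g j0.1) [:: (j0.2, true)] by rewrite /T /K' eqxx.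
  have Ts j : j \in s -> T K' j = T K j.
    by move=> Hj; rewrite /T /K' ifN //; apply: contraNneq Nj0 => <-.
  have bH j : b j \in [seq b j | j <- enum {: J}] ++ [seq T K j | j <- s].
    by rewrite mem_cat map_f // mem_enum.
  have TH j : j \in s -> T K j \in [seq b j | j <- enum {: J}] ++ [seq T K j | j <- s].
    by move=> Hj; rewrite mem_cat (map_f (T K)) // orbT.
  exists K'; split=> [j Lj|j j'|j j'].
  - by rewrite /K'; case: eqP => [->|_] //; exact: H1.
  - rewrite in_cons => /orP[/eqP->|Hj] Lj Lj'; first by rewrite T0; apply: gen.
    by rewrite Ts //; exact: H2.
  rewrite !in_cons => /orP[/eqP->|Hj] /orP[/eqP->|Hj'] Lj Lj'.
  - by move=> _; exact: com_refl.
  - rewrite T0 Ts // => /(gen _ (TH _ Hj')) C; apply: com_sym; apply: H2 => //.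
    exact: com_sym.
  - rewrite T0 Ts // => /com_sym /(gen _ (TH _ Hj)) C; apply: H2 => //.
    exact: com_sym.
  by rewrite !Ts //; exact: H3.
pose k j := K (rep j) ++ g (rep j).1.
have tE j : L j -> wconj (k j) [:: (j.2, true)] = T K (rep j).
  by move=> Lj; rewrite /T /k rep2.
have Lrep j : L j -> L (rep j) by move/repP/clsP => [].
exists L, b, k => t; split=> [//|j|j j'|j j' Lj Lj' C].
- by rewrite negbK => /eqP E; rewrite /b E; exact: req_mulVw.
- have [Lj|NL] := boolP (L j); last first.
    move=> _; apply: com_sym; apply: com_req1; move: NL; rewrite negbK => /eqP E.
    by rewrite /b E; exact: req_mulVw.
  have [Lj'|NL] := boolP (L j'); last first.
    move=> _; apply: com_req1; move: NL; rewrite negbK => /eqP E.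
    by rewrite /b E; exact: req_mulVw.
  rewrite /t !tE // => /(HK _ _ (Lrep _ Lj) (Lrep _ Lj')) C.
  apply: (clsC _ _ _ (cls_sym _ _ (repP _ Lj))); apply: com_sym.
  apply: (clsC _ _ _ (cls_sym _ _ (repP _ Lj'))); exact: com_sym.
have {}C := comb _ _ C.
have {}C : com e (b (rep j)) (b (rep j')).
  apply: (clsC _ _ _ (repP _ Lj)); apply: com_sym.
  apply: (clsC _ _ _ (repP _ Lj')); exact: com_sym.
(* Commuting factors with equal supports form one class and share their conjugate; otherwise
   [commuting_conjugates] applies. *)
rewrite /t !tE //; have [ES|NS] := eqVneq (supp (wc (rep j))) (supp (wc (rep j'))).
  suff -> : rep j = rep j' by exact: com_refl.
  apply: rep_eq; apply: (cls_trans _ _ _ (repP _ Lj)); apply: (cls_trans _ (rep j')); last exact/cls_sym/repP.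
  by apply: clsI => //; exact: Lrep.
by apply: (commuting_conjugates e_sym e_irr (irr _ (Lrep _ Lj)) (irr _ (Lrep _ Lj')) C);
   [exact/eqP | exact/SK/Lrep | exact/SK/Lrep | exact/memr/Lrep | exact/memr/Lrep].
Qed.

End Pattern.

(** * Vertex conjugates in an inflation *)

Section Inflation.
Variables (V : finType) (e : rel V) (n : nat).
Hypotheses (e_sym : symmetric e) (e_irr : irreflexive e).
Variable i0 : 'I_n.

Definition infl_sec (v : V) : word (V * 'I_n)%type := [:: ((v, i0), true)].

Definition infl_ret (a : V * 'I_n) : word V := [:: (a.1, true)].

Lemma infl_sec_hom : is_hom e (infl_rel e n) infl_sec.
Proof.
apply: is_hom_com => x y Hxy; apply: com_letter; rewrite /= /infl_rel /= ifN ?Hxy ?orbT //.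
by apply: contraTneq Hxy => ->; rewrite e_irr.
Qed.

Lemma infl_ret_hom : is_hom (infl_rel e n) e infl_ret.
Proof.
apply: is_hom_com => -[x i] [y j]; rewrite /infl_rel /= => H; apply: com_letter => /=.
by case: eqP H.
Qed.

Lemma infl_secK w : hom_ext infl_ret (hom_ext infl_sec w) = w.
Proof.
rewrite hom_ext_comp; elim: w => // -[x b] w IH.
by rewrite -cat1s hom_ext_cat IH; case: b.
Qed.

Lemma infl_star v i y : star e v y -> star (infl_rel e n) (v, i) (y, i0).
Proof.
rewrite /star /infl_rel xpair_eqE /= => /orP[/eqP->|H].
  by rewrite !eqxx (eq_sym i); case: (i0 == i).
by case: (v =P y) H => [->|_ ->]; rewrite ?e_irr ?orbT.
Qed.

Lemma over_infl_sec v i w : over (star e v) w ->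
  over (star (infl_rel e n) (v, i)) (hom_ext infl_sec w).
Proof.
elim: w => // -[y b] w IH /andP[/= Hy /IH Hw]; rewrite -cat1s hom_ext_cat over_cat Hw andbT.
by case: b; rewrite /hom_ext /over /= infl_star.
Qed.

(** The retraction gives one direction. For the other, [commuting_conjugate_factor] splits the
    relative conjugator into parts over the stars of [u] and [v]; their lifts lie over the stars of
    any copies of [u] and [v]. *)
Lemma infl_com_conj k k' u v i j :
  com (infl_rel e n) (wconj (hom_ext infl_sec k) [:: ((u, i), true)])
                     (wconj (hom_ext infl_sec k') [:: ((v, j), true)]) <->
  com e (wconj k [:: (u, true)]) (wconj k' [:: (v, true)]).
Proof.
have [s ir] := @infl_simple V e n e_sym e_irr; set e' := infl_rel e n in s ir *.
have ret w c : hom_ext infl_ret (wconj (hom_ext infl_sec w) [:: (c, true)]) =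
    wconj w [:: (c.1, true)].
  by rewrite /wconj !hom_ext_cat hom_ext_winv infl_secK.
split=> [/(hom_com infl_ret_hom)|C]; first by rewrite !ret.
 set f := hom_ext infl_sec.
have : com e (wconj (k ++ winv k') [:: (u, true)]) [:: (v, true)].
  by rewrite wconj_cat; apply: com_sym; apply/com_wconjr; exact: com_sym.
case/(commuting_conjugate_factor e_sym e_irr) => q [q' [Hq Sq Sq' Suv]].
have C1 : com e' (wconj (f k ++ winv (f k')) [:: ((u, i), true)]) [:: ((v, j), true)].
  have E : raag_eq e' (f k ++ winv (f k')) (f q ++ f q').
    by have := infl_sec_hom Hq; rewrite !hom_ext_cat hom_ext_winv.
  apply: com_req (req_wconjl _ (req_sym E)) (req_refl e' _) _; rewrite wconj_cat.
  have C2 : com e' (f q') [:: ((v, j), true)].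
    by apply/com_sym/com_star/over_infl_sec.
  apply: (com_req _ (wconj_com C2)); last first.
    apply: com_wconj (_ : com e' [:: ((u, i), true)] _).
    apply: com_letter; rewrite /= xpair_eqE /e' /infl_rel /=.
    case/orP: Suv => [/eqP->|H]; first by rewrite !eqxx /=; case: (i == j).
    by case: (u =P v) H => [->|_ ->]; rewrite ?e_irr ?orbT.
  apply/req_wconj/req_sym/wconj_com/com_sym/com_star/over_infl_sec; exact: Sq.
apply: com_sym; apply/com_wconjr; apply: com_sym.
by move: C1; rewrite wconj_cat.
Qed.

End Inflation.

(** * Construction of the tame embedding *)

Lemma finite_witnesses (T : finType) (X : eqType) (Q : T -> X -> Prop) :
  exists ws : seq X, (forall t, (exists w, Q t w) -> exists2 w, w \in ws & Q t w) /\
    forall w, w \in ws -> exists t, Q t w.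
Proof.
suff [ws [H1 H2]] : exists ws : seq X,
    (forall t, t \in enum T -> (exists w, Q t w) -> exists2 w, w \in ws & Q t w) /\
    forall w, w \in ws -> exists t, Q t w.
  by exists ws; split=> // t; apply: H1; rewrite mem_enum.
elim: (enum T) => [|t s [ws [H1 H2]]]; first by exists [::].
have [[w Hw]|N] := classic (exists w, Q t w).
  exists (w :: ws); split=> [t'|w'].
    rewrite in_cons => /orP[/eqP-> _|Ht' /(H1 _ Ht') [w' Hw' HQ]].
      by exists w => //; exact: mem_head.
    by exists w' => //; rewrite in_cons Hw' orbT.
  by rewrite in_cons => /orP[/eqP->|/H2 //]; exists t.
exists ws; split=> // t'; rewrite in_cons => /orP[/eqP-> /N //|]; exact: H1.
Qed.

Lemma flatten_enum_val (V : finType) (T : Type) (f : V -> seq T) :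
  flatten [seq f (enum_val j) | j <- enum 'I_#|V|] = flatten [seq f v | v <- enum V].
Proof.
have -> : enum V = [seq enum_val j | j <- enum 'I_#|V|]; last by rewrite -map_comp.
have Sz : size (enum V) = size [seq (enum_val j : V) | j <- enum 'I_#|V|].
  by rewrite size_map size_enum_ord cardE.
have [x|V0] := pickP (fun _ : V => true); last first.
  have E : size (enum V) = 0 by rewrite -cardE; apply: eq_card0 => x; have := V0 x.
  by rewrite (size0nil E) (size0nil (etrans (esym Sz) E)).
move=> _; apply: (@eq_from_nth _ x) => // i Hi; rewrite -cardE in Hi.
by rewrite (nth_map (Ordinal Hi)) ?size_enum_ord // (nth_ord_enum _ (Ordinal Hi)) (enum_val_nth x).
Qed.

Lemma univ_tame (VD VG : finType) (eD : rel VD) (eG : rel VG) :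
  simple_graph eD -> simple_graph eG ->
  (forall f, models_univ eG f -> models_univ eD f) ->
  exists phi : VD -> word (VG * 'I_#|VD|)%type, tame_embedding eD (infl_rel eG #|VD|) phi.
Proof.
(* A pattern is a set of letters in use with a set of commuting pairs; [bad] records a non-trivial
   element in the kernel of its [theta]. *)
move=> [sD iD] [sG iG] HU; pose J := (VD * VG)%type.
pose theta (L : {set J}) x : word J := [seq ((x, v), true) | v <- enum VG & (x, v) \in L].
pose crel (C : {set J * J}) : rel J := fun j j' => (j, j') \in C.
pose bad (P : {set J} * {set J * J}) w :=
  ~ raag_eq eD w [::] /\ raag_eq (crel P.2) (hom_ext (theta P.1) w) [::].
have [ws [Hws1 Hws2]] := finite_witnesses bad.
have [w /Hws2 [P []] //|a [acom Ha]] := univ_discriminates (ws := ws) HU.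
have [L [b [k [aE bL tb at']]]] := pure_factor_pattern sG iG a.
pose t (j : J) := wconj (k j) [:: (j.2, true)].
pose L0 := [set j | L j].
pose C0 := [set p : J * J | (p.1 != p.2) && reqb eG (t p.1 ++ t p.2) (t p.2 ++ t p.1)].
have C0P j j' : j != j' -> crel C0 j j' <-> com eG (t j) (t j').
  move=> N; rewrite /crel inE /= N /=; split=> [/(reqP sG iG)//|]; by move/(reqP sG iG).
have cs : symmetric (crel C0).
  move=> j j'; rewrite /crel !inE /= eq_sym; congr andb.
  by apply/(reqP sG iG)/(reqP sG iG) => /com_sym.
have ci : irreflexive (crel C0) by move=> j; rewrite /crel inE /= eqxx.
have thetaP x l : l \in theta L0 x -> exists2 v, L (x, v) & l = ((x, v), true).
  by case/mapP => v; rewrite mem_filter inE => /andP[Lv _] ->; exists v.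
have theta_hom : is_hom eD (crel C0) (theta L0).
  apply: is_hom_com => x y Hxy; apply: com_words => l l' /thetaP [v Lv ->] /thetaP [u Lu ->] /=.
  have N : (x, v) != (y, u) by rewrite xpair_eqE; apply: contraTN Hxy => /andP[/eqP-> _]; rewrite iD.
  by apply/orP; right; apply/(C0P _ _ N); apply: at' => //=; exact: acom.
have b_hom : is_hom (crel C0) eG b.
  apply: is_hom_com => j j' Hj; apply: tb; apply/C0P => //.
  by apply: contraTneq Hj => ->; rewrite ci.
have ab w : raag_eq eG (hom_ext b (hom_ext (theta L0) w)) (hom_ext a w).
  rewrite hom_ext_comp; apply: hom_ext_req => x; apply: req_sym; apply: req_trans (aE x) _.
  rewrite /theta; elim: (enum VG) => [|v s IH] /=; first exact: req_refl.
  rewrite inE; case: ifP => Lv; first exact: req_cat (req_refl eG _) IH.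
  by apply: (@req_cat _ _ _ [::]) => //; apply: bL; rewrite Lv.
(* If [theta] were not injective, [ws] would contain a kernel element for [(L0, C0)]; but [a]
   factors through [theta] and is non-trivial on [ws]. *)
have theta_ker w : raag_eq (crel C0) (hom_ext (theta L0) w) [::] -> raag_eq eD w [::].
  move=> Hw; apply: NNPP => Nw.
  have [|w' Hw' [_ H]] := Hws1 (L0, C0); first by exists w.
  apply: (Ha _ Hw'); apply: req_trans (req_sym (ab w')) _; exact: b_hom H.
(* a constant, made to depend on [x] because ['I_#|VD|] may be empty *)
pose i0 (x : VD) : 'I_#|VD| := enum_rank (odflt x [pick y : VD]).
have i0E x y : i0 x = i0 y by rewrite /i0; case: pickP => // /(_ x).
(* The copy index remembers [x], so letters with the same [v] but different [x] get different
   vertices of the inflation. *)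
pose lab (j : J) : VG * 'I_#|VD| := (j.2, enum_rank j.1).
have lab_inj : injective lab by move=> [x v] [y u] [-> /enum_rank_inj ->].
pose sk (j : J) := hom_ext (@infl_sec VG #|VD| (i0 j.1)) (k j).
have [sI iI] := @infl_simple VG eG #|VD| sG iG.
have HC j j' : j != j' -> crel C0 j j' <->
    com (infl_rel eG #|VD|) (wconj (sk j) [:: (lab j, true)]) (wconj (sk j') [:: (lab j', true)]).
  move=> N; rewrite C0P // /sk (i0E j'.1 j.1); apply: iff_sym; exact: infl_com_conj.
have [N Hemb] := pingpong sI iI cs ci lab_inj HC.
set Psi := fun j => _ in Hemb.
have [Psi_hom Psi_inj] := Hemb.
exists (fun x => hom_ext Psi (theta L0 x)); split.
  apply: is_embedding_ker => [w1 w2 Hw|w].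
    by rewrite -!hom_ext_comp; apply: Psi_hom; apply: theta_hom.
  by rewrite -hom_ext_comp => /(Psi_inj _ [::]) /theta_ker.
(* Every [v] gets a piece. Outside [L] the exponent is 0, so the image does not change, and the
   conjugates are still distinct because their labels are. *)
exists (fun=> #|VG|), (fun x j => let v := enum_val j in
  (lab (x, v), (if L (x, v) then Posz N else Posz 0), sk (x, v))).
pose pc x v := if L (x, v) then Psi (x, v) else wconj (sk (x, v)) [::].
have pcE x (j : 'I_#|VG|) : tame_piece (let v := enum_val j in
    (lab (x, v), (if L (x, v) then Posz N else Posz 0), sk (x, v))) = pc x (enum_val j).
  by rewrite /tame_piece /pc /=; case: ifP.
split; [|split].
- move=> x; under eq_map do rewrite pcE.
  rewrite (flatten_enum_val (pc x)) /theta.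
  elim: (enum VG) => [|v s IH] /=; first exact: req_refl.
  have [Lv|NL] := boolP (L (x, v)); rewrite inE ?Lv ?(negbTE NL).
    have -> : pc x v = Psi (x, v) by rewrite /pc Lv.
    exact: req_cat (req_refl _ _) IH.
  have -> : pc x v = wconj (sk (x, v)) [::] by rewrite /pc (negbTE NL).
  by apply: (@req_cat _ _ [::]) => //; apply/req_sym/req_mulVw.
- move=> x j j'; rewrite !pcE /pc.
  have Ctriv z w : com (infl_rel eG #|VD|) z (wconj w [::]) by apply/com_req1/req_mulVw.
  case: ifP => Lj; last by apply: com_sym; exact: Ctriv.
  case: ifP => Lj'; last exact: Ctriv.
  have [->|Nj] := eqVneq (x, enum_val j) (x, enum_val j'); first exact: com_refl.
  rewrite -!(hom_ext1 Psi); apply: (hom_com Psi_hom).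
  by apply: req_swap; apply/C0P => //; apply: at' => //; exact: com_refl.
(* The exponent sum at the label of the first conjugate is 1 there and 0 on the second. *)
move=> x x' j j' Njj /(esum_req (lab (x, enum_val j))).
rewrite /tame_conj !esum_wconj /= eqxx ifN //.
rewrite (inj_eq lab_inj) xpair_eqE eq_sym; apply/negP => /andP[/eqP Ex /eqP /enum_val_inj Ej].
by case: Njj => [|]; [rewrite Ex | rewrite Ej].
Qed.

Theorem theorem4p13 (VD VG : finType) (eD : rel VD) (eG : rel VG) (n m : nat) :
  simple_graph eD -> simple_graph eG -> #|VD| = n -> #|VG| = m ->
  (univ_equiv eD eG <->
   ((exists phi : VD -> word (VG * 'I_n)%type, tame_embedding eD (infl_rel eG n) phi) /\
    (exists psi : VG -> word (VD * 'I_m)%type, tame_embedding eG (infl_rel eD m) psi))).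
Proof.
move=> HD HG <- <-; split=> [HU|[[phi [Hphi _]] [psi [Hpsi _]]]].
  by split; apply: univ_tame => // f; have [] := HU f.
have [[sD iD] [sG iG]] := (HD, HG); move=> f; split.
  exact: embedding_univ sD iD Hpsi.
exact: embedding_univ sG iG Hphi.
Qed.
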